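(* Let $(M,J,[\nabla])$ be a complex projective surface. A necessary condition for $(M,J,[\nabla])$ to be Kähler metrisable is that it is Liouville-flat, i.e. its complex projective Liouville curvature vanishes.
   Context: Complex projective surfaces. $M$ is a complex $2$-manifold with integrable almost complex structure $J$. A complex-linear connection is an affine torsion-free connection $\nabla$ on $TM$ with $\nabla J=0$. A generalised geodesic of $\nabla$ is a smoothly immersed curve $\gamma\subset M$ such that the $2$-plane spanned by $\dot\gamma$ and $J\dot\gamma$ is parallel along $\gamma$, i.e. $\nabla_{\dot\gamma}\dot\gamma\wedge\dot\gamma\wedge J\dot\gamma=0$. Two complex-linear torsion-free connections are complex projectively equivalent if they have the same generalised geodesics; an equivalence class $[\nabla]$ is a complex projective structure, and $(M,J,[\nabla])$ is a complex projective surface. It is Kähler metrisable if $[\nabla]$ arises via the Levi-Civita connection of a (pseudo-)Kähler metric on $(M,J)$, i.e. if some (pseudo-)Kähler metric has Levi-Civita connection belonging to $[\nabla]$. Indices $i,j,k,l,s,\dots$ run over $\{1,2\}$ and repeated indices are summed. In local holomorphic coordinates $z=(z^1,z^2):U\to\mathbb{C}^2$ the complex Christoffel symbols are defined by $\nabla_{\partial_{z^j}}\partial_{z^k}=\Gamma^i_{jk}\partial_{z^i}$, and $$\Pi^i_{jk}=\Gamma^i_{jk}-\tfrac13\left(\Gamma^l_{lj}\delta^i_k+\Gamma^l_{lk}\delta^i_j\right)$$ depends only on $[\nabla]$ and the coordinates $z$. Cartan geometry (known fact). Let $P\subset \mathrm{PSL}(3,\mathbb{C})$ be the stabiliser of $[1,0,0]^t\in\mathbb{CP}^2$.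 There is, up to isomorphism, a unique real Cartan geometry $(\pi:B\to M,\theta)$ of type $(\mathrm{PSL}(3,\mathbb{C}),P)$, with $\theta=(\theta^a_b)_{a,b=0,1,2}$ (row index $a$, column index $b$, $\theta$ trace-free), such that for every local holomorphic coordinate system $z$ on $U\subset M$ there is a unique section $\sigma_z:U\to B$ with $\sigma_z^*\theta^0_0=0$, $\sigma_z^*\theta^i_0=\mathrm{d}z^i$, $\sigma_z^*\theta^i_j=\Pi^i_{jk}\mathrm{d}z^k$, $\sigma_z^*\theta^0_i=\Pi_{ik}\mathrm{d}z^k$, where $\Pi_{ij}=\Pi^k_{il}\Pi^l_{jk}-\partial\Pi^k_{ij}/\partial z^k$. Curvature. $\Theta=\mathrm{d}\theta+\theta\wedge\theta$ satisfies $\Theta^0_0=\Theta^i_0=0$ and $$\Theta^0_i=L_i\,\theta^1_0\wedge\theta^2_0+K_{il\bar\jmath}\,\theta^l_0\wedge\overline{\theta^j_0},\qquad \Theta^i_k=W^i_{kl\bar\jmath}\,\theta^l_0\wedge\overline{\theta^j_0}$$ for unique complex-valued functions $L_i,K_{il\bar\jmath},W^i_{kl\bar\jmath}$ on $B$ with $W^l_{li\bar\jmath}=0$. The complex projective Liouville curvature is the tensor field $\lambda$ on $M$ with $\pi^*\lambda=(L_1\theta^1_0+L_2\theta^2_0)\otimes(\theta^1_0\wedge\theta^2_0)$; it vanishes if and only if $L_1=L_2=0$ on $B$. *)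

(* Defs.v *)
From HB Require Import structures.
From mathcomp Require Import all_boot all_order all_algebra.
From mathcomp Require Import complex.
From mathcomp Require Import ring.
From mathcomp Require Import all_classical all_reals all_analysis.

Set Implicit Arguments.
Unset Strict Implicit.
Unset Printing Implicit Defensive.

Import Order.TTheory GRing.Theory Num.Theory.
Import numFieldNormedType.Exports.

Local Open Scope classical_set_scope.
Local Open Scope ring_scope.

(* The real vector space underlying C^2: the row (x^1, x^2, y^1, y^2) stands
   for (z^1, z^2) with z^k = x^k + i y^k. The ordinals 0, 1 : 'I_2 play the role
   of the indices 1, 2. *)
Notation "''C2' R" := ('rV[R]_(2 + 2)) (at level 8, R at level 2).

Section ComplexPlane.
Variable R : realType.
Local Notation V := ('C2 R).
Local Notation C := R[i].

Definition J0 (v : V) : V := row_mx (- rsubmx v) (lsubmx v).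

Definition dz (k : 'I_2) (v : V) : C :=
  Complex (lsubmx v 0 k) (rsubmx v 0 k).

(* the real coordinate vector d/dx^k *)
Definition ex (k : 'I_2) : V := row_mx (delta_mx 0 k) 0.

Lemma dz_J0 (k : 'I_2) (v : V) : dz k (J0 v) = 'i%C * dz k v.
Proof.
rewrite /dz /J0 row_mxKl row_mxKr mxE; apply/eqP; rewrite eq_complex /=.
by rewrite !mul0r !mul1r sub0r add0r !eqxx.
Qed.

Lemma dz_ex (k j : 'I_2) : dz k (ex j) = (k == j)%:R.
Proof.
rewrite /dz /ex row_mxKl row_mxKr !mxE eqxx /=; apply/eqP.
by case: (k == j); rewrite eq_complex /= !eqxx.
Qed.

(* The complex-bilinear extension of a real-bilinear B, evaluated at
   d/dz^j = (d/dx^j - i J d/dx^j) / 2 and d/dz^k. *)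
Definition eval_dzdz (B : V -> V -> C) (j k : 'I_2) : C :=
  4^-1 * (B (ex j) (ex k) - 'i%C * B (J0 (ex j)) (ex k)
          - 'i%C * B (ex j) (J0 (ex k)) - B (J0 (ex j)) (J0 (ex k))).

(* directional derivative of a complex-valued function *)
Definition cderive (v : V) (f : V -> C) (x : V) : C :=
  Complex ('D_v (fun y => complex.Re (f y)) x) 
         ('D_v (fun y => complex.Im (f y)) x).

Definition wirtinger (k : 'I_2) (f : V -> C) (x : V) : C :=
  2^-1 * (cderive (ex k) f x - 'i%C * cderive (J0 (ex k)) f x).

(* Component of the trivector a /\ b /\ c along the coordinates f 0, f 1, f 2. *)
Definition wedge3 (a b c : V) (f : 'I_3 -> 'I_(2 + 2)) : R :=
  \det (\matrix_(r < 3, s < 3) (tnth [tuple a; b; c] r) 0 (f s)).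

End ComplexPlane.

Section Smooth.
Variables (R : realType) (E F : normedModType R).

Fixpoint times_differentiable (n : nat) (U : set E) (f : E -> F) : Prop :=
  if n is m.+1 then
    (forall x, U x -> differentiable f x) /\
    (forall v, times_differentiable m U (fun x => 'D_v f x))
  else True.

(* meant for open U *)
Definition smooth_on (U : set E) (f : E -> F) : Prop :=
  forall n, times_differentiable n U f.

End Smooth.

Definition holomorphic_on (R : realType) (U : set ('C2 R))
    (f : 'C2 R -> 'C2 R) : Prop :=
  smooth_on U f /\
  forall x, U x -> forall v, 'D_(J0 v) f x = J0 ('D_v f x).

Section ComplexSurface.
Variables (R : realType) (M : topologicalType).
Local Notation V := ('C2 R).

(* The values of coord and coord_inv outside dom and coord @` dom are junk. *)
Record chart := Chart {
  dom : set M;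
  coord : M -> V;
  coord_inv : V -> M;
  dom_open : open dom;
  cod_open : open (coord @` dom);
  coordK : forall p, dom p -> coord_inv (coord p) = p;
  coord_continuous : forall p, dom p -> {for p, continuous coord};
  coord_inv_continuous :
    forall x, (coord @` dom) x -> {for x, continuous coord_inv} }.

Definition cod (phi : chart) : set V := coord phi @` dom phi.

Definition overlap (phi psi : chart) : set V :=
  coord phi @` (dom phi `&` dom psi).

Definition transition (phi psi : chart) (x : V) : V :=
  coord psi (coord_inv phi x).

Definition compatible (phi psi : chart) : Prop :=
  holomorphic_on (overlap phi psi) (transition phi psi) /\
  holomorphic_on (overlap psi phi) (transition psi phi).

(* A complex 2-manifold structure on M. As the atlas is maximal, its members
   are all the local holomorphic coordinate systems. Tensors and connections are
   described below by their expressions in the members of the atlas; as the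
   charts are holomorphic, J is expressed by the constant J0. *)
Record complex_surface := ComplexSurface {
  atlas : set chart;
  surface_hausdorff : hausdorff_space M;
  surface_second_countable : @second_countable M;
  atlas_cover : forall p, exists2 phi, atlas phi & dom phi p;
  atlas_compatible :
    forall phi psi, atlas phi -> atlas psi -> compatible phi psi;
  atlas_maximal :
    forall psi, (forall phi, atlas phi -> compatible phi psi) -> atlas psi }.

End ComplexSurface.

Section Connections.
Variables (R : realType) (M : topologicalType) (S : complex_surface R M).
Local Notation V := ('C2 R).

(* In a chart, nabla_u v = 'D_u v + christoffel u v. The last field says that
   nabla_u v does not depend on the chart: for every vector field v,
   'D_u ('D_v tau) + christoffel' ('D_u tau) ('D_v tau)
     = 'D_(christoffel u v) tau, where tau is the change of coordinates. *)
Record affine_connection := AffineConnection {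
  christoffel : chart R M -> V -> V -> V -> V;
  christoffel_linl : forall phi x, atlas S phi -> cod phi x ->
    forall v, linear (fun u => christoffel phi x u v);
  christoffel_linr : forall phi x, atlas S phi -> cod phi x ->
    forall u, linear (christoffel phi x u);
  christoffel_smooth : forall phi, atlas S phi ->
    forall u v, smooth_on (cod phi) (fun x => christoffel phi x u v);
  christoffel_transition : forall phi psi, atlas S phi -> atlas S psi ->
    forall x, overlap phi psi x -> forall u v,
    let tau := transition phi psi in
    'D_u (fun y => 'D_v tau y) x
      + christoffel psi (tau x) ('D_u tau x) ('D_v tau x)
    = 'D_(christoffel phi x u v) tau x }.

Definition torsion_free (nabla : affine_connection) : Prop :=
  forall phi x, atlas S phi -> cod phi x ->
  forall u v, christoffel nabla phi x u v = christoffel nabla phi x v u.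

(* (nabla_u J) v = christoffel u (J v) - J (christoffel u v), the matrix of J
   being constant in holomorphic coordinates. *)
Definition J_parallel (nabla : affine_connection) : Prop :=
  forall phi x, atlas S phi -> cod phi x ->
  forall u v, christoffel nabla phi x u (J0 v) = J0 (christoffel nabla phi x u v).

Record complex_connection := ComplexConnection {
  complex_connection_affine :> affine_connection;
  complex_connection_torsion_free : torsion_free complex_connection_affine;
  complex_connection_J_parallel : J_parallel complex_connection_affine }.

Definition curve_in (phi : chart R M) (gamma : R -> M) (t : R) : V :=
  coord phi (gamma t).

Definition velocity (phi : chart R M) (gamma : R -> M) (t : R) : V :=
  (curve_in phi gamma)^`()%classic t.

Definition immersed_curve (I : set R) (gamma : R -> M) : Prop :=
  [/\ open I /\ is_interval I,
      forall t, I t -> {for t, continuous gamma} &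
      forall phi, atlas S phi ->
        smooth_on (I `&` gamma @^-1` dom phi) (curve_in phi gamma) /\
        forall t, I t -> dom phi (gamma t) -> velocity phi gamma t != 0].

Definition acceleration (nabla : affine_connection) (phi : chart R M)
    (gamma : R -> M) (t : R) : V :=
  (curve_in phi gamma)^`(2)%classic t
  + christoffel nabla phi (curve_in phi gamma t)
      (velocity phi gamma t) (velocity phi gamma t).

Definition generalised_geodesic (nabla : affine_connection) (I : set R)
    (gamma : R -> M) : Prop :=
  immersed_curve I gamma /\
  forall phi t, atlas S phi -> I t -> dom phi (gamma t) ->
  forall f, wedge3 (acceleration nabla phi gamma t)
    (velocity phi gamma t) (J0 (velocity phi gamma t)) f = 0.

Definition complex_projectively_equivalent (nabla nabla' : complex_connection)
    : Prop :=
  forall I gamma,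
    generalised_geodesic nabla I gamma <-> generalised_geodesic nabla' I gamma.

Record complex_projective_structure := ComplexProjectiveStructure {
  projective_class : set complex_connection;
  projective_classP : exists nabla,
    projective_class = [set nabla' | complex_projectively_equivalent nabla nabla'] }.

Record pseudo_kahler_metric := PseudoKahlerMetric {
  metric : chart R M -> V -> V -> V -> R;
  metric_lin : forall phi x, atlas S phi -> cod phi x ->
    forall u, scalar (metric phi x u);
  metric_sym : forall phi x, atlas S phi -> cod phi x ->
    forall u v, metric phi x u v = metric phi x v u;
  metric_nondegenerate : forall phi x, atlas S phi -> cod phi x ->
    forall u, (forall v, metric phi x u v = 0) -> u = 0;
  metric_smooth : forall phi, atlas S phi ->
    forall u v, smooth_on (cod phi) (fun x => metric phi x u v);
  metric_transition : forall phi psi, atlas S phi -> atlas S psi ->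
    forall x, overlap phi psi x -> forall u v,
    let tau := transition phi psi in
    metric psi (tau x) ('D_u tau x) ('D_v tau x) = metric phi x u v;
  metric_hermitian : forall phi x, atlas S phi -> cod phi x ->
    forall u v, metric phi x (J0 u) (J0 v) = metric phi x u v;
  (* d omega = 0 for omega (u, v) = g (J u, v) *)
  kahler_form_closed : forall phi x, atlas S phi -> cod phi x ->
    forall u v w,
    'D_u (fun y => metric phi y (J0 v) w) x
    + 'D_v (fun y => metric phi y (J0 w) u) x
    + 'D_w (fun y => metric phi y (J0 u) v) x = 0 }.

Definition levi_civita (g : pseudo_kahler_metric) (nabla : affine_connection)
    : Prop :=
  torsion_free nabla /\
  forall phi x, atlas S phi -> cod phi x -> forall u v w,
    'D_w (fun y => metric g phi y u v) x
    = metric g phi x (christoffel nabla phi x w u) v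
      + metric g phi x u (christoffel nabla phi x w v).

Definition kahler_metrisable (P : complex_projective_structure) : Prop :=
  exists (g : pseudo_kahler_metric) (nabla : complex_connection),
    projective_class P nabla /\ levi_civita g nabla.

End Connections.

Section LiouvilleCurvature.
Variables (R : realType) (M : topologicalType) (S : complex_surface R M).
Variables (nabla : complex_connection S) (phi : chart R M).
Local Notation V := ('C2 R).
Local Notation C := R[i].

(* dz^i (nabla_{d/dz^j} d/dz^k) *)
Definition complex_christoffel (i j k : 'I_2) (x : V) : C :=
  eval_dzdz (fun u v => dz i (christoffel nabla phi x u v)) j k.

Definition Pi3 (i j k : 'I_2) (x : V) : C :=
  complex_christoffel i j k x
  - 3^-1 * (\sum_l complex_christoffel l l j x * (i == k)%:R
            + \sum_l complex_christoffel l l k x * (i == j)%:R).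

Definition Pi2 (i j : 'I_2) (x : V) : C :=
  \sum_k \sum_l Pi3 k i l x * Pi3 l j k x
  - \sum_k wirtinger k (Pi3 k i j) x.

(* The pullback of the Cartan connection theta by the section attached to the
   coordinates z, as a matrix-valued 1-form; in 'M_(1 + 2) the index 0 is
   lshift 2 0 and the indices i = 1, 2 are rshift 1 i. *)
Definition cartan_form (x u : V) : 'M[C]_(1 + 2) :=
  block_mx 0 (\row_i \sum_k Pi2 i k x * dz k u)
           (\col_i dz i u) (\matrix_(i, j) \sum_k Pi3 i j k x * dz k u).

(* d theta + theta /\ theta *)
Definition cartan_curvature (x u v : V) : 'M[C]_(1 + 2) :=
  \matrix_(a, b) (cderive u (fun y => cartan_form y v a b) x
                  - cderive v (fun y => cartan_form y u a b) x)
  + (cartan_form x u *m cartan_form x v - cartan_form x v *m cartan_form x u).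

Definition curvature_0i (i : 'I_2) (x u v : V) : C :=
  ursubmx (cartan_curvature x u v) 0 i.

(* L_i, extracted as the value of Theta^0_i at (d/dz^1, d/dz^2); see
   liouville_coefE. *)
Definition liouville_coef (i : 'I_2) (x : V) : C :=
  eval_dzdz (curvature_0i i x) 0 1.

Lemma liouville_coefE (i : 'I_2) (x : V) (L : C) (K : 'I_2 -> 'I_2 -> C) :
  (forall u v, curvature_0i i x u v =
     L * (dz 0 u * dz 1 v - dz 0 v * dz 1 u)
     + \sum_l \sum_j K l j * (dz l u * (dz j v)^*%C - dz l v * (dz j u)^*%C)) ->
  liouville_coef i x = L.
Proof.
move=> curvE; rewrite /liouville_coef /eval_dzdz !curvE.
have conjiM (z : C) : ('i%C * z)^*%C = - ('i%C * z^*%C).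
  by case: z => a b; apply/eqP; rewrite eq_complex /=; apply/andP; split; apply/eqP; ring.
have conjn n : (n%:R : C)^*%C = n%:R by rewrite (rmorph_nat (@conjc R)).
rewrite !big_ord_recl !big_ord0 !dz_J0 !dz_ex !conjiM !conjn /=.
have i2 : 'i%C * 'i%C = -1 :> C by rewrite -expr2 sqr_i.
move: (lift ord0 ord0) i2 => o; set I := 'i%C => i2.
by field: i2.
Qed.

(* lambda = (L_1 dz^1 + L_2 dz^2) (x) (dz^1 /\ dz^2) *)
Definition liouville_curvature (x u v w : V) : C :=
  (\sum_i liouville_coef i x * dz i u) * (dz 0 v * dz 1 w - dz 0 w * dz 1 v).

End LiouvilleCurvature.

(* The forms above only depend on nabla through its complex projective class. *)
Definition liouville_flat (R : realType) (M : topologicalType)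
    (S : complex_surface R M) (P : complex_projective_structure S) : Prop :=
  forall nabla : complex_connection S, projective_class P nabla ->
  forall phi x, atlas S phi -> cod phi x ->
  forall u v w, liouville_curvature nabla phi x u v w = 0.

(* Main.v *)
(** Let h = g + i g(., J .), a form that is complex-linear in its first argument.
   As the Levi-Civita connection nabla0 preserves g and J, its Christoffel symbols
   satisfy d_k h(e_i, v) = G^l_ki h(e_l, v) for d_k = d/dz^k. Since d_1 and d_2
   commute and h is nondegenerate, G is flat in the holomorphic directions:
   d_n G^s_mk - d_m G^s_nk = G^l_nk G^s_ml - G^l_mk G^s_nl.
   With p_j = G^l_lj / 3, flatness makes p closed and reduces Pi_ij to
   p_k G^k_ij - p_i p_j - d_i p_j; then L_i = 0 is a polynomial identity, as for
   the Cotton tensor of a flat projective structure.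

   It remains to see that the Pi^i_jk, hence L_i, are the same for all members
   nabla of the class. Two members with the same generalised geodesics through x
   in the direction v satisfy (G' - G)(v, v) in C v. This needs a generalised
   geodesic for every initial direction: the ordinary geodesics of nabla, given by
   the Picard-Lindeloef theorem. *)

From HB Require Import structures.
From mathcomp Require Import all_boot all_order all_algebra.
From mathcomp Require Import complex.
From mathcomp Require Import ring lra.
From mathcomp Require Import all_classical all_reals all_analysis.
Require Import Defs.

Set Implicit Arguments.
Unset Strict Implicit.
Unset Printing Implicit Defensive.

Import Order.TTheory GRing.Theory Num.Theory.
Import numFieldNormedType.Exports.

Local Open Scope classical_set_scope.
Local Open Scope ring_scope.

(** Projective equivalence speaks of curves in [M] tested in every chart, whereas an ODE yields a
    curve in one chart. The second-order chain rule and the transformation law of [christoffel] show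
    that its acceleration vanishes in the other charts too. In return, few initial velocities are
    needed: the Christoffel symbols are complex-bilinear, so real combinations of [ex 0] and [ex 1]
    suffice to control all components.

    In the flatness step the second argument v of h stays a constant real vector. As h is
    conjugate-linear there, the contribution of G(d_k, v) cancels along d_k, and what remains is a
    linear first-order system for the h(e_i, v), with flatness as its integrability condition.

    The final identity has a geometric reason: Pi arises from the flat G by a projective change with
    one-form p, and the reduced Pi_ij is -(nabla_i p_j + p_i p_j). Second derivatives of p enter L_i
    only through d_1 d_i p_2 - d_2 d_i p_1, which is zero because p is closed; so the identity can
    be checked with derivatives as formal symbols. *)

Lemma near_eq_differentiable (R : numFieldType) (V W : normedModType R)
    (f g : V -> W) (x : V) :
  (\forall y \near x, f y = g y) -> differentiable f x -> differentiable g x.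
Proof.
(* The correction [g - f] vanishes near [x], hence has differential 0 there. *)
move=> fg df; rewrite (_ : g = f + (g - f)); last by rewrite addrC subrK.
apply: differentiableD => //; set k := g - f.
have k0 : \forall y \near x, k y = 0.
  by apply: filterS fg => y fgy; rewrite /k /= !fctE fgy subrr.
have kx : k x = 0 := nbhs_singleton k0.
have kE : k \o shift x = cst (k x) + 0 +o_ 0 id.
  apply/eqaddoP => _/posnumP[e] /=.
  rewrite [\forall x \near _, _ <= _](near_shift x) sub0r; near=> y.
  rewrite /= !fctE /= kx add0r subr0 subrK.
  by rewrite (near k0) // normr0 mulr_ge0.
have dk : 'd k x = 0 :> (V -> W).
  by apply: diff_unique kE => y; exact: cvg_cst.
by apply/diff_locallyP; rewrite dk; split=> // y; exact: cvg_cst.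
Unshelve. all: by end_near. Qed.

(** * Smooth functions *)

Section SmoothCalculus.
Variable R : realType.

Section Scalar.
Variables (E F : normedModType R).
Implicit Types (U : set E) (f g : E -> F).

(** As [U] is open, agreement on [U] is agreement near each of its points, and so passes to
    directional derivatives. *)
Lemma times_differentiable_eq n U f g : open U -> (forall x, U x -> f x = g x) ->
  times_differentiable n U f -> times_differentiable n U g.
Proof.
move=> oU; elim: n f g => //= n IH f g fg [df dDf].
have nfg x : U x -> \forall y \near x, f y = g y.
  by move=> Ux; apply: filterS (open_nbhs_nbhs (conj oU Ux)) => y; exact: fg.
split=> [x Ux|v]; first exact: near_eq_differentiable (nfg x Ux) (df x Ux).
by apply: IH (dDf v) => x Ux; exact: near_eq_derive (nfg x Ux).
Qed.

Lemma times_differentiable_sub n U U' f : U' `<=` U ->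
  times_differentiable n U f -> times_differentiable n U' f.
Proof.
move=> U'U; elim: n f => //= n IH f [df dDf]; split=> [x /U'U|v]; first exact: df.
exact: IH.
Qed.

Lemma times_differentiableW n U f :
  times_differentiable n.+1 U f -> times_differentiable n U f.
Proof.
elim: n f => // n IH f [df dDf]; split=> // v; exact: IH.
Qed.

Lemma times_differentiable_cst n U (a : F) : times_differentiable n U (cst a).
Proof.
elim: n a => //= n IH a; split=> // v.
by rewrite (_ : 'D_v _ = cst 0)//; apply/funext => x; rewrite derive_cst.
Qed.

Lemma times_differentiableD n U f g : open U ->
  times_differentiable n U f -> times_differentiable n U g ->
  times_differentiable n U (f + g).
Proof.
move=> oU; elim: n f g => //= n IH f g [df dDf] [dg dDg]; split=> [x Ux|v].
  exact: differentiableD (df _ Ux) (dg _ Ux).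
apply: times_differentiable_eq (IH _ _ (dDf v) (dDg v)) => // x Ux.
by rewrite deriveD//; apply: diff_derivable; [exact: df|exact: dg].
Qed.

Lemma times_differentiable_sum n U (I : Type) (r : seq I) (f : I -> E -> F) :
  open U -> (forall i, times_differentiable n U (f i)) ->
  times_differentiable n U (fun x => \sum_(i <- r) f i x).
Proof.
move=> oU df; rewrite -fct_sumE; elim/big_ind: _ => [|g h|i _] //.
- exact: (@times_differentiable_cst _ _ 0).
- by move=> *; exact: times_differentiableD.
Qed.

End Scalar.

Section ToReal.
Variable (E : normedModType R).
Implicit Types (U : set E) (f g : E -> R).

Lemma times_differentiableM n U f g : open U ->
  times_differentiable n U f -> times_differentiable n U g ->
  times_differentiable n U (fun x => f x * g x).
Proof.
move=> oU; elim: n f g => // n IH f g df dg; move: (df) (dg) => [/= df0 df1] [/= dg0 dg1].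
split=> /= [x Ux|v]; first exact: differentiableM (df0 _ Ux) (dg0 _ Ux).
(* The Leibniz rule leaves one factor undifferentiated; its order is lowered to fit the induction
   hypothesis. *)
have d1 := IH _ _ (times_differentiableW df) (dg1 v).
have d2 := IH _ _ (times_differentiableW dg) (df1 v).
apply: times_differentiable_eq (times_differentiableD oU d1 d2) => // x Ux.
by rewrite deriveM//; apply: diff_derivable; [exact: df0|exact: dg0].
Qed.

End ToReal.

Section ToMatrix.
Variables (E : normedModType R) (p q : nat).
Implicit Types (U : set E) (f : E -> 'M[R]_(p, q)).

Lemma differentiable_mxP f x :
  differentiable f x <-> forall i j, differentiable (fun y => f y i j) x.
Proof.
split=> [df i j|df].
  by apply: (@differentiable_comp _ _ _ _ f (fun M => M i j)) => //; exact: differentiable_coord.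
have -> : f = \sum_i \sum_j (fun y => f y i j *: delta_mx i j).
  apply/funext => y; rewrite fct_sumE [LHS]matrix_sum_delta.
  by apply: eq_bigr => i _; rewrite fct_sumE.
do 2 (apply: differentiable_sum => ?).
exact/differentiableZl/df.
Qed.

Lemma derive_mx_entry f x v i j : differentiable f x ->
  'D_v f x i j = 'D_v (fun y => f y i j) x.
Proof. by move=> df; rewrite derive_mx ?mxE//; exact: diff_derivable. Qed.

Lemma times_differentiable_mxP n U f : open U ->
  times_differentiable n U f <->
  forall i j, times_differentiable n U (fun y => f y i j).
Proof.
move=> oU; elim: n f => // n IH f; split=> [/= [df dDf] i j|df]; split=> /=.
- by move=> x /df /differentiable_mxP.
- move=> v; apply: times_differentiable_eq (((IH _).1 (dDf v)) i j) => // x Ux.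
  by rewrite derive_mx_entry//; exact: df.
- by move=> x Ux; apply/differentiable_mxP => i j; have [+ _] := df i j; exact.
- move=> v; apply/IH => i j; have [_ /(_ v)] := df i j.
  apply: times_differentiable_eq => // x Ux; rewrite derive_mx_entry//.
  by apply/differentiable_mxP => k l; have [+ _] := df k l; exact.
Qed.

End ToMatrix.
End SmoothCalculus.

Section ChainRule.
Variable R : realType.

Section Direction.
Variables (E F : normedModType R) (f : E -> F) (x : E).
Hypothesis df : differentiable f x.

Lemma derive_dirP (a : R) (u v : E) : 'D_(a *: u + v) f x = a *: 'D_u f x + 'D_v f x.
Proof. by rewrite !deriveE// linearP. Qed.

Lemma derive_dirZ (a : R) (u : E) : 'D_(a *: u) f x = a *: 'D_u f x.
Proof. by rewrite !deriveE// linearZ. Qed.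

Lemma derive_dir_sum (I : Type) (r : seq I) (v : I -> E) :
  'D_(\sum_(i <- r) v i) f x = \sum_(i <- r) 'D_(v i) f x.
Proof.
by rewrite deriveE// linear_sum; apply: eq_bigr => i _; rewrite deriveE.
Qed.

End Direction.

Lemma derive_comp (E F G : normedModType R) (f : E -> F) (g : F -> G) (x v : E) :
  differentiable f x -> differentiable g (f x) ->
  'D_v (g \o f) x = 'D_('D_v f x) g (f x).
Proof.
move=> df dg.
have dgf : differentiable (g \o f) x by exact: differentiable_comp df dg.
rewrite (deriveE _ dgf) (deriveE _ dg) (deriveE _ df).
exact: (congr1 (fun h => h v) (diff_comp df dg)).
Qed.

Lemma derive_row_basis (F : normedModType R) m (g : 'rV[R]_m -> F) (x v : 'rV[R]_m) :
  differentiable g x -> 'D_v g x = \sum_i v 0 i *: 'D_(delta_mx 0 i) g x.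
Proof.
move=> dg; rewrite [X in 'D_X g x](row_sum_delta v) derive_dir_sum//.
by apply: eq_bigr => i _; rewrite derive_dirZ.
Qed.

(** The chain rule differentiates [g] in the direction ['D_v f x], which moves with [x]. Expanding
    it in the basis leaves derivatives of [g] in constant directions, to which the induction
    hypothesis applies. *)
Lemma times_differentiable_comp n (E : normedModType R) m (U : set E)
    (W : set 'rV[R]_m) (f : E -> 'rV[R]_m) (g : 'rV[R]_m -> R) :
  open U -> open W -> (forall x, U x -> W (f x)) ->
  times_differentiable n U f -> times_differentiable n W g ->
  times_differentiable n U (fun x => g (f x)).
Proof.
move=> oU oW UW; elim: n g => // n IH g df dg; move: (df) (dg) => [/= df0 df1] [/= dg0 dg1].
split=> /= [x Ux|v]; first exact: differentiable_comp (df0 _ Ux) (dg0 _ (UW _ Ux)).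
apply: (@times_differentiable_eq _ _ _ _ _
  (fun x => \sum_i ('D_v f x) 0 i * 'D_(delta_mx 0 i) g (f x))) => //.
  move=> x Ux; rewrite (@derive_comp _ _ _ f g)//; [|exact: df0|exact/dg0/UW].
  by rewrite derive_row_basis//; exact/dg0/UW.
apply: times_differentiable_sum => // i; apply: times_differentiableM => //.
  exact: ((times_differentiable_mxP _ _ _).1 (df1 v)).
exact: IH (times_differentiableW df) (dg1 _).
Qed.

Lemma times_differentiable_comp_mx n (E : normedModType R) m p q (U : set E)
    (W : set 'rV[R]_m) (f : E -> 'rV[R]_m) (g : 'rV[R]_m -> 'M[R]_(p, q)) :
  open U -> open W -> (forall x, U x -> W (f x)) ->
  times_differentiable n U f -> times_differentiable n W g ->
  times_differentiable n U (fun x => g (f x)).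
Proof.
move=> oU oW UW df dg; apply/times_differentiable_mxP => // i j.
apply: (@times_differentiable_comp n E m U W f (fun y => g y i j)) => //.
by have [/(_ dg i j)] := times_differentiable_mxP n g oW.
Qed.

End ChainRule.

(** * Symmetry of second derivatives *)

Section Schwarz.
Variables (R : realType) (E : normedModType R).

Lemma is_derive_line (f : E -> R) (x v : E) (t : R) :
  differentiable f (x + t *: v) ->
  is_derive t 1 (fun s : R => f (x + s *: v)) ('D_v f (x + t *: v)).
Proof.
move=> df.
pose k (s : R) := s *: v; pose l := cst x + k.
have did : differentiable (id : R -> R) t by exact: ex_diff.
have dk : differentiable k t by exact: differentiableZl did.
have dlt : differentiable l t by apply: differentiableD dk.
have lE : 'D_1 l t = v.
  rewrite deriveD ?derive_cst ?add0r; [|exact: derivable_cst|exact: diff_derivable].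
  rewrite (deriveE _ dk).
  have := congr1 (fun g => g 1) (diffZl v did) => /= ->.
  by rewrite diff_val scale1r.
apply: (@DeriveDef _ _ _ _ _ (f \o l)).
  by apply: diff_derivable; exact: differentiable_comp.
by rewrite (derive_comp _ dlt df) lE.
Qed.

Lemma mean_value (f df : R -> R) (h : R) : 0 < h ->
  (forall t, t \in `[0, h] -> is_derive t 1 f (df t)) ->
  exists2 t, t \in `]0, h[ & f h - f 0 = df t * h.
Proof.
move=> h0 fdf.
have fdf' t : t \in `]0, h[ -> is_derive t 1 f (df t).
  by move=> th; exact: fdf (subset_itv_oo_cc th).
have fc : {within `[0, h], continuous f}.
  by apply: derivable_within_continuous => t th; case: (fdf t th).
have [t th e] := MVT h0 fdf' fc.
by exists t; rewrite // e subr0.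
Qed.

(* Two successive applications of the mean value theorem. The left-hand side is
   symmetric in u and v, whence the symmetry of second derivatives. *)
Lemma second_difference (f : E -> R) (x u v : E) (h : R) : 0 < h ->
  (forall s t, s \in `[0, h] -> t \in `[0, h] ->
     differentiable f (x + s *: u + t *: v) /\
     differentiable ('D_u f) (x + s *: u + t *: v)) ->
  exists s t, [/\ s \in `]0, h[, t \in `]0, h[ &
    f (x + h *: u + h *: v) - f (x + h *: u) - (f (x + h *: v) - f x)
    = 'D_v ('D_u f) (x + s *: u + t *: v) * h ^+ 2].
Proof.
move=> h0 df.
have h00 : 0 \in `[0, h] by rewrite in_itv /= lexx ltW.
have hh : h \in `[0, h] by rewrite in_itv /= lexx ltW.
have [s sh sE] : exists2 s, s \in `]0, h[ &
    f (x + h *: v + h *: u) - f (x + h *: u) - (f (x + h *: v) - f x)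
    = ('D_u f (x + h *: v + s *: u) - 'D_u f (x + s *: u)) * h.
  have := @mean_value
    (fun s => f (x + h *: v + s *: u) - f (x + s *: u))
    (fun s => 'D_u f (x + h *: v + s *: u) - 'D_u f (x + s *: u)) h h0.
  rewrite /= scale0r !addr0; apply => t th; apply: is_deriveB.
    by apply: is_derive_line; rewrite addrAC; have [] := df t h th hh.
  by apply: is_derive_line; rewrite -[_ + _]addr0 -[0](scale0r v); have [] := df t 0 th h00.
have [t th tE] : exists2 t, t \in `]0, h[ &
    'D_u f (x + s *: u + h *: v) - 'D_u f (x + s *: u)
    = 'D_v ('D_u f) (x + s *: u + t *: v) * h.
  have := @mean_value (fun t => 'D_u f (x + s *: u + t *: v))
     (fun t => 'D_v ('D_u f) (x + s *: u + t *: v)) h h0.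
  rewrite /= scale0r addr0; apply => t th; apply: is_derive_line.
  by have [] := df s t (subset_itv_oo_cc sh) th.
exists s, t; split=> //.
by rewrite [x + h *: u + _]addrAC sE [x + h *: v + _]addrAC tE expr2 mulrA.
Qed.

(** Both mixed derivatives, each taken at some point near [x], equal the same second difference
    divided by [h ^+ 2]. Order 3 makes them differentiable, hence continuous at [x]. *)
Lemma derive_symmetric (U : set E) (f : E -> R) (x u v : E) :
  open U -> U x -> times_differentiable 3 U f ->
  'D_u ('D_v f) x = 'D_v ('D_u f) x.
Proof.
move=> oU Ux df; apply/eqP; rewrite -subr_eq0 -normr_le0.
apply/ler_addgt0Pr => e e0; rewrite add0r.
have [d0 d1] := df; have [du0 du1] := d1 u; have [dv0 dv1] := d1 v.
have cA : {for x, continuous ('D_u ('D_v f))}.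
  by apply: differentiable_continuous; have [+ _] := dv1 u; exact.
have cB : {for x, continuous ('D_v ('D_u f))}.
  by apply: differentiable_continuous; have [+ _] := du1 v; exact.
have e20 : 0 < e / 2 by rewrite divr_gt0.
have nU : \forall y \near x, U y by exact: open_nbhs_nbhs.
have nA : \forall y \near x, `|'D_u ('D_v f) x - 'D_u ('D_v f) y| < e / 2.
  by move/cvgrPdist_lt: cA; apply.
have nB : \forall y \near x, `|'D_v ('D_u f) x - 'D_v ('D_u f) y| < e / 2.
  by move/cvgrPdist_lt: cB; apply.
have /nbhs_ballP[r /= r0 br] : \forall y \near x, [/\ U y,
    `|'D_u ('D_v f) x - 'D_u ('D_v f) y| < e / 2 &
    `|'D_v ('D_u f) x - 'D_v ('D_u f) y| < e / 2].
  by apply: filterS3 nU nA nB => y; split.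
(* With this size the parallelogram spanned by [h *: u] and [h *: v] at [x] stays in the ball of
   radius [r]; the summand 1 covers the case of zero [u] and [v]. *)
pose h := r / (`|u| + `|v| + 1).
have n0 : 0 < `|u| + `|v| + 1 by rewrite ltr_wpDl// addr_ge0.
have h0 : 0 < h by rewrite divr_gt0.
have bU s t : s \in `[0, h] -> t \in `[0, h] -> ball x r (x + s *: u + t *: v).
  rewrite !in_itv /= => /andP[s0 sh] /andP[t0 th].
  rewrite -ball_normE /ball_ /= -addrA opprD addNKr normrN.
  apply: le_lt_trans (ler_normD _ _) _; rewrite !normrZ !ger0_norm//.
  apply: (@le_lt_trans _ _ (h * (`|u| + `|v|))).
    by rewrite mulrDr lerD// ler_wpM2r.
  by rewrite -[ltRHS](@divfK _ (`|u| + `|v| + 1)) ?gt_eqF// ltr_pM2l// ltrDl.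
have [|s [t [sh th E1]]] := @second_difference f x u v h h0.
  by move=> s t sh th; have [Uy _ _] := br _ (bU _ _ sh th); split; [exact: d0|exact: du0].
have [|s' [t' [sh' th']]] := @second_difference f x v u h h0.
  move=> s' t' sh' th'; rewrite addrAC; have [Uy _ _] := br _ (bU _ _ th' sh').
  by split; [exact: d0|exact: dv0].
rewrite [x + h *: v + _]addrAC (_ : _ - (_ - f x) =
  f (x + h *: u + h *: v) - f (x + h *: u) - (f (x + h *: v) - f x)); last by ring.
rewrite E1 => /(mulIf (lt0r_neq0 (exprn_gt0 2 h0))) AB.
have [_ + _] := br _ (bU _ _ (subset_itv_oo_cc th') (subset_itv_oo_cc sh')).
have [_ _ +] := br _ (bU _ _ (subset_itv_oo_cc sh) (subset_itv_oo_cc th)).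
rewrite AB (addrAC x (t' *: u)).
move: ('D_u ('D_v f) x) ('D_v ('D_u f) x) ('D_u ('D_v f) _) => a b c bc ac.
rewrite -(subrKA c); apply: le_trans (ler_normD _ _) _.
by rewrite (splitr e) [`|c - b|]distrC; apply: lerD; exact: ltW.
Qed.

End Schwarz.

(** * Ordinary differential equations *)

Section Picard.
Variable R : realType.

Lemma ler_geometric (a b C : R) : (forall n, a <= b + C / 2 ^+ n) -> a <= b.
Proof.
move=> ab; apply/ler_addgt0Pr => e e0.
have [C0|C0] := leP C 0.
  apply: le_trans (ab 0) _; rewrite lerD2l expr0 divr1.
  exact: le_trans C0 (ltW e0).
have := @upper_nthrootP _ (C / e) _ (leqnn _); set n := Num.Def.archi_bound _ => nP.
apply: le_trans (ab n) _; rewrite lerD2l ler_pdivrMr ?exprn_gt0//.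
by rewrite mulrC -ler_pdivrMr// ltW.
Qed.

(** The tail of the geometric series from index [n] on is [2 * C / 2 ^+ n]. *)
Lemma geometric_limit (u : nat -> R) (C : R) :
  (forall n, `|u n.+1 - u n| <= C / 2 ^+ n) ->
  exists l, forall n, `|l - u n| <= 2 * C / 2 ^+ n.
Proof.
move=> uC.
have C0 : 0 <= C by have := uC 0%N; rewrite expr0 divr1; exact: le_trans.
(* The bound is the exact partial sum of the series; the subtracted term is what lets the induction
   on [k] close. *)
have dist n k : `|u (n + k)%N - u n| <= 2 * C / 2 ^+ n - 2 * C / 2 ^+ (n + k).
  elim: k => [|k IH]; first by rewrite addn0 !subrr normr0.
  rewrite addnS -(subrKA (u (n + k)%N)); apply: le_trans (ler_normD _ _) _.
  apply: le_trans (lerD (uC _) IH) _.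
  rewrite exprS invfM; set x := (2 ^+ n)^-1; set y := (2 ^+ _)^-1.
  by rewrite le_eqVlt; apply/orP; left; apply/eqP; field.
have dist2 n k : `|u (n + k)%N - u n| <= 2 * C / 2 ^+ n.
  apply: le_trans (dist n k) _; rewrite lerBlDr lerDl.
  by rewrite divr_ge0// ?mulr_ge0// exprn_ge0.
have cu : cvg (u @ \oo).
  apply/cauchy_cvgP/cauchy_exP => e e0.
  have := @upper_nthrootP _ (2 * C / e) _ (leqnn _); set n := Num.Def.archi_bound _ => nP.
  exists (u n); exists n => //= m /= nm; rewrite -ball_normE /ball_ /= distrC.
  rewrite -(subnKC nm); apply: le_lt_trans (dist2 _ _) _.
  by rewrite ltr_pdivrMr ?exprn_gt0// [ltRHS]mulrC -ltr_pdivrMr.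
exists (lim (u @ \oo)) => n; apply/ler_addgt0Pr => e e0.
have [N _ NP] := (cvgrPdist_lt _ _).1 cu _ e0.
have /NP /= h : (N <= n + N)%N by exact: leq_addl.
rewrite -(subrKA (u (n + N)%N)) [leRHS]addrC; apply: le_trans (ler_normD _ _) _.
by apply: lerD (dist2 _ _); exact: ltW.
Qed.

Lemma derive_bound_lipschitz (f df : R -> R) (a b K : R) : a <= b ->
  (forall t, t \in `[a, b] -> is_derive t 1 f (df t)) ->
  (forall t, t \in `[a, b] -> `|df t| <= K) ->
  `|f b - f a| <= K * (b - a).
Proof.
move=> ab fdf dK.
have fdf' t : t \in `]a, b[ -> is_derive t 1 f (df t).
  by move=> th; exact: fdf (subset_itv_oo_cc th).
have fc : {within `[a, b], continuous f}.
  by apply: derivable_within_continuous => t th; case: (fdf t th).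
have [t th ->] := MVT_segment ab fdf' fc.
rewrite normrM [`|b - a|]ger0_norm ?subr_ge0// ler_wpM2r ?subr_ge0//; exact: dK.
Qed.

Lemma derive_bound_lipschitz_sym (f df : R -> R) (h K s t : R) :
  (forall t, t \in `[- h, h] -> is_derive t 1 f (df t)) ->
  (forall t, t \in `[- h, h] -> `|df t| <= K) ->
  s \in `[- h, h] -> t \in `[- h, h] -> `|f s - f t| <= K * `|s - t|.
Proof.
move=> fdf dK; wlog ts : s t / t <= s.
  move=> W; have [ts|/ltW st] := leP t s; first exact: W.
  by move=> sh th; rewrite distrC [`|s - t|]distrC; exact: W.
move=> sh th.
have sub r : r \in `[t, s] -> r \in `[- h, h].
  move: sh th; rewrite !in_itv /= => /andP[_ sh] /andP[ht _] /andP[tr rs].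
  by rewrite (le_trans ht tr) (le_trans rs sh).
rewrite [`|s - t|]ger0_norm ?subr_ge0//.
exact: (@derive_bound_lipschitz f df t s K ts (fun r rh => fdf r (sub r rh))
  (fun r rh => dK r (sub r rh))).
Qed.

Lemma primitive_exists (f : R -> R) (h : R) : 0 < h -> continuous f ->
  exists2 F : R -> R, F 0 = 0 &
    forall t, t \in `[- h, h] -> is_derive t 1 F (f t).
Proof.
move=> h0 cf.
(* The integral starts at [- (h + 1)] and the fundamental theorem is applied up to [h + 1], so that
   all of [[- h, h]] is interior and has two-sided derivatives. *)
pose G (x : R) := (\int[lebesgue_measure]_(t in `[- (h + 1), x]) f t)%R.
exists (fun x => G x - G 0); first by rewrite subrr.
move=> t; rewrite in_itv /= => /andP[ht th].
have [||||dG G'] := @continuous_FTC1_closed R f (- (h + 1)) t (h + 1).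
- by rewrite (le_lt_trans th)// ltrDl.
- apply: continuous_compact_integrable; first exact: segment_compact.
  exact: continuous_subspaceT.
- by rewrite (lt_le_trans _ ht)// ltrN2 ltrDl.
- exact: cf.
rewrite derive1E in G'.
have dG' : is_derive t 1 G (f t) by apply: DeriveDef.
by rewrite -[f t]subr0; apply: is_deriveB.
Qed.

Definition clamp (h t : R) : R := Num.max (- h) (Num.min h t).

Lemma clamp_itv h t : 0 <= h -> clamp h t \in `[- h, h].
Proof.
by move=> h0; rewrite in_itv /= /clamp le_max lexx ge_max ge_min lexx /= andbT; lra.
Qed.

Lemma clamp_id h t : t \in `[- h, h] -> clamp h t = t.
Proof. by rewrite in_itv /= => /andP[? ?]; rewrite /clamp min_r// max_r. Qed.

Lemma clamp_lipschitz h s t : `|clamp h s - clamp h t| <= `|s - t|.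
Proof.
have h1 := ler_norm (s - t); have h2 := ler_norm (t - s).
rewrite distrC in h2.
rewrite /clamp ler_norml /Num.max /Num.min.
by do !case: ifP => /=; rewrite -?(rwP negPf) -?real_leNgt ?num_real// => *; lra.
Qed.

End Picard.

Section PicardTheorem.
Variable R : realType.

Lemma lipschitz_continuous (V W : normedModType R) (f : V -> W) (K : R) :
  (forall x y, `|f x - f y| <= K * `|x - y|) -> continuous f.
Proof.
move=> fK x; apply/cvgrPdist_lt => e e0.
have K1 : 0 < `|K| + 1 by rewrite ltr_wpDl.
have : \forall y \near x, `|x - y| < e / (`|K| + 1).
  apply/nbhs_ballP; exists (e / (`|K| + 1)); first by rewrite /= divr_gt0.
  by move=> y; rewrite -ball_normE.
apply: filterS => y; rewrite ltr_pdivlMr// => xy.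
apply: le_lt_trans (fK x y) _; apply: le_lt_trans xy.
by rewrite mulrC ler_wpM2l// (le_trans (ler_norm K))// lerDl.
Qed.

Lemma row_norm_le n (v : 'rV[R]_n) (K : R) : 0 <= K ->
  (forall i, `|v 0 i| <= K) -> `|v| <= K.
Proof.
move=> K0 vK; rewrite /Num.Def.normr /= mx_normrE bigmax_le// => -[i j] _ /=.
by rewrite (ord1 i).
Qed.

Lemma ler_row_norm n (v : 'rV[R]_n) i : `|v 0 i| <= `|v|.
Proof.
rewrite [leRHS]/Num.Def.normr /= mx_normrE.
by apply: (le_trans _ (le_bigmax _ _ (0, i))).
Qed.

(* P f is a primitive of f that is kept constant outside [-h, h]; all bounds hold on
   the whole line, so that the Picard iterates are globally Lipschitz. *)
Lemma truncated_primitive (h : R) : 0 < h ->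
  exists P : (R -> R) -> R -> R, forall f, continuous f ->
  [/\ P f 0 = 0,
      forall t, t \in `]- h, h[ -> is_derive t 1 (P f) (f t),
      forall K s t, (forall r, `|f r| <= K) -> `|P f s - P f t| <= K * `|s - t| &
      forall g K t, continuous g -> (forall r, `|f r - g r| <= K) ->
        `|P f t - P g t| <= K * h].
Proof.
move=> h0.
have prim f : exists F : R -> R, continuous f -> F 0 = 0 /\
    forall t, t \in `[- h, h] -> is_derive t 1 F (f t).
  (* Continuity sits inside the existential so that [choice] gives a total operator; its value at a
     discontinuous [f] is arbitrary. *)
  have [cf|ncf] := pselect (continuous f); last by exists f.
  by have [F F0 Ff] := primitive_exists h0 cf; exists F.
have [Q QP] := choice prim.
have h00 : 0 \in `[- h, h] by rewrite in_itv /= oppr_le0 ltW.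
exists (fun f t => Q f (clamp h t)) => f cf; have [Q0 dQ] := QP f cf.
have cl t : clamp h t \in `[- h, h] by apply: clamp_itv; exact: ltW.
split=> [|t th|K s t fK|g K t cg fgK].
- by rewrite clamp_id.
- apply: (@near_eq_is_derive _ _ _ (Q f)); last exact: dQ (subset_itv_oo_cc th).
  near=> r; rewrite clamp_id//; apply: subset_itv_oo_cc; near: r.
  exact: near_in_itvoo.
- apply: le_trans (derive_bound_lipschitz_sym dQ (fun r _ => fK r) (cl s) (cl t)) _.
  by rewrite ler_wpM2l ?clamp_lipschitz// (le_trans _ (fK 0)).
- have [Qg0 dQg] := QP g cg.
  have dfg r : r \in `[- h, h] -> is_derive r 1 (Q f - Q g) (f r - g r).
    by move=> rh; exact: is_deriveB (dQ r rh) (dQg r rh).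
  have := derive_bound_lipschitz_sym dfg (fun r _ => fgK r) (cl t) h00.
  rewrite /= !fctE Q0 Qg0 !subr0 => /le_trans; apply.
  rewrite ler_wpM2l// ?(le_trans _ (fgK 0))//.
  by have := cl t; rewrite in_itv /= ler_norml.
Unshelve. all: by end_near. Qed.

(** Global bounds on [F] let the integral operator [T] act on functions on the whole line. It
    preserves [K]-Lipschitz functions, which keeps the integrands continuous, and it halves sup
    distances; the iterates therefore converge geometrically to a fixed point. *)
Lemma picard n (F : 'rV[R]_n -> 'rV[R]_n) (L K : R) (x0 : 'rV[R]_n) :
  (forall x y, `|F x - F y| <= L * `|x - y|) -> (forall x, `|F x| <= K) ->
  exists (h : R) (y : R -> 'rV[R]_n), [/\ 0 < h, y 0 = x0 &
    forall t, t \in `]- h, h[ -> is_derive t 1 y (F (y t))].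
Proof.
move=> FL FK.
(* Chosen so that [|L| * h <= 1/2], the contraction factor of [T]; the absolute value is there
   because the sign of [L] is unknown. *)
pose h := (2 * (`|L| + 1))^-1.
have L1 : 0 < `|L| + 1 by rewrite ltr_wpDl.
have h0 : 0 < h by rewrite invr_gt0 mulr_gt0.
have Lh : `|L| * h <= 2^-1.
  rewrite /h invfM mulrCA ler_piMr ?invr_ge0// ler_pdivrMr// mul1r.
  by rewrite lerDl.
have K0 : 0 <= K by apply: le_trans (FK 0).
have [P PP] := truncated_primitive h0.
pose T (y : R -> 'rV[R]_n) t := x0 + \row_i P (fun s => F (y s) 0 i) t.
pose lip (y : R -> 'rV[R]_n) := forall s t, `|y s - y t| <= K * `|s - t|.
have cF y i : lip y -> continuous (fun s => F (y s) 0 i).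
  move=> ly; apply: (@lipschitz_continuous _ _ _ (`|L| * K)) => s t.
  have -> : F (y s) 0 i - F (y t) 0 i = (F (y s) - F (y t)) 0 i by rewrite !mxE.
  apply: le_trans (ler_row_norm _ _) _; apply: le_trans (FL _ _) _.
  apply: (@le_trans _ _ (`|L| * `|y s - y t|)); first by rewrite ler_wpM2r// ler_norm.
  by rewrite -mulrA ler_wpM2l.
have FiK y i r : `|F (y r) 0 i| <= K by apply: le_trans (ler_row_norm _ _) (FK _).
have Tlip y : lip y -> lip (T y).
  move=> ly s t; rewrite /T opprD addrACA subrr add0r.
  apply: row_norm_le => [|i]; first by rewrite mulr_ge0.
  rewrite !mxE; have [_ _ + _] := PP _ (cF y i ly); apply => r; exact: FiK.
have Tcontr y z d : lip y -> lip z -> (forall r, `|y r - z r| <= d) ->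
    forall t, `|T y t - T z t| <= d / 2.
  move=> ly lz yz t; rewrite /T opprD addrACA subrr add0r.
  have d0 : 0 <= d := le_trans (normr_ge0 _) (yz 0).
  apply: row_norm_le => [|i]; first by rewrite divr_ge0.
  rewrite !mxE; have [_ _ _ H] := PP _ (cF y i ly).
  apply: (le_trans (H _ (`|L| * d) t (cF z i lz) _)) => [r|].
    have -> : F (y r) 0 i - F (z r) 0 i = (F (y r) - F (z r)) 0 i by rewrite !mxE.
    apply: le_trans (ler_row_norm _ _) _; apply: le_trans (FL _ _) _.
    apply: (@le_trans _ _ (`|L| * `|y r - z r|)); first by rewrite ler_wpM2r// ler_norm.
    by rewrite ler_wpM2l.
  by rewrite mulrAC mulrC ler_wpM2l.
pose y_ k := iter k T (cst x0).
have ylip k : lip (y_ k).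
  elim: k => [s t|k]; last exact: Tlip.
  by rewrite /y_ /= subrr normr0 mulr_ge0.
pose C := K * h.
have ydist k t : `|y_ k.+1 t - y_ k t| <= C / 2 ^+ k.
  elim: k t => [t|k IH t].
    rewrite expr0 divr1 /y_ /= /T addrAC subrr add0r.
    apply: row_norm_le => [|i]; first by rewrite mulr_ge0// ltW.
    rewrite mxE; have [_ _ _ H] := PP _ (cF (cst x0) i (ylip 0%N)).
    have c0 : continuous (cst 0 : R -> R) by move=> ?; exact: cvg_cst.
    have [P00 _ P0 _] := PP _ c0.
    (* The first step is bounded by comparing with the primitive of the zero function, which starts
       at 0 and is Lipschitz with constant 0. *)
    have P0t : P (cst 0) t = 0.
      have := P0 0 t 0 (fun r => _); rewrite P00 subr0 mul0r normr_le0.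
      by move=> /(_ (fun r => eq_ind_r (fun z => z <= 0) (lexx 0) (normr0 _)))/eqP.
    have := H (cst 0) K t c0; rewrite P0t subr0; apply => r.
    by rewrite subr0; exact: le_trans (ler_row_norm _ _) (FK _).
  have -> : C / 2 ^+ k.+1 = C / 2 ^+ k / 2 by rewrite exprS invfM mulrA mulrAC.
  exact: Tcontr (ylip _) (ylip _) IH t.
have lim t i : exists l, forall k, `|l - y_ k t 0 i| <= 2 * C / 2 ^+ k.
  apply: geometric_limit => k.
  have -> : y_ k.+1 t 0 i - y_ k t 0 i = (y_ k.+1 t - y_ k t) 0 i by rewrite !mxE.
  exact: le_trans (ler_row_norm _ _) (ydist k t).
pose l t := projT1 (choice (lim t)).
have lP t i k : `|l t i - y_ k t 0 i| <= 2 * C / 2 ^+ k := projT2 (choice (lim t)) i k.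
pose y t := \row_i l t i.
have C0 : 0 <= C by rewrite mulr_ge0// ltW.
have yP k t : `|y t - y_ k t| <= 2 * C / 2 ^+ k.
  apply: row_norm_le => [|i]; last by rewrite !mxE; exact: lP.
  exact: divr_ge0 (mulr_ge0 _ C0) (exprn_ge0 _ _).
(* The Lipschitz bound survives the limit; without it [T y] would not be known to be a primitive. *)
have ly : lip y.
  move=> s t; apply: (@ler_geometric _ _ _ (4 * C)) => k.
  rewrite -(subrKA (y_ k s)); apply: le_trans (ler_normD _ _) _.
  rewrite -[y_ k s - y t](subrKA (y_ k t)).
  apply: le_trans (lerD (yP k s) (ler_normD _ _)) _.
  have := yP k t; have := ylip k s t; rewrite [`|y_ k t - _|]distrC.
  move: `|_| `|_| (K * _) (2 ^+ k)^-1 => a b c d ac bd; lra.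
(* Both sides are within a multiple of [2 ^- k] of the iterate [y_ k.+1]. *)
have yT t : y t = T y t.
  apply/eqP; rewrite -subr_eq0 -normr_le0; apply: (@ler_geometric _ _ _ (2 * C)) => k.
  rewrite add0r -(subrKA (y_ k.+1 t)); apply: le_trans (ler_normD _ _) _.
  have h1 := yP k.+1 t.
  have h2 : `|y_ k.+1 t - T y t| <= 2 * C / 2 ^+ k / 2.
    by apply: Tcontr => // r; rewrite distrC; exact: yP.
  apply: le_trans (lerD h1 h2) _; rewrite exprS invfM.
  by move: (2 ^+ k)^-1 => d; lra.
exists h, y; split=> //.
  rewrite yT /T; apply/rowP => i; rewrite !mxE.
  by have [-> _ _ _] := PP _ (cF y i ly); rewrite addr0.
move=> t th.
have dy i j : is_derive t 1 (fun s => y s i j) (F (y t) i j).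
  rewrite (ord1 i) (_ : (fun s => _) = cst (x0 0 j) + P (fun s => F (y s) 0 j)); last first.
    by apply/funext => s; rewrite yT !mxE.
  rewrite -[F _ _ _]add0r; apply: is_deriveD.
  by have [_ + _ _] := PP _ (cF y j ly); apply.
have dv : derivable y t 1 by apply/derivable_mxP => i j; case: (dy i j).
apply: DeriveDef => //; rewrite derive_mx//; apply/matrixP => i j; rewrite mxE.
by case: (dy i j).
Qed.
End PicardTheorem.

Section SmoothOde.
Variable R : realType.

Lemma times_differentiable_coord n k (U : set 'rV[R]_k) (j : 'I_k) : open U ->
  times_differentiable n U (fun s : 'rV[R]_k => s 0 j).
Proof.
move=> oU; case: n => // n; split=> [x _|v]; first exact: differentiable_coord.
rewrite (_ : 'D_v _ = cst (v 0 j)); first exact: times_differentiable_cst.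
apply/funext => x.
have := @derive_mx_entry R _ 1 k id x v 0 j; rewrite derive_id => <- //.
Qed.

(* A 1-Lipschitz retraction onto the closed ball of radius r around x0 (the norm is
   the sup norm); composing with it makes a local vector field global. *)
Definition row_clamp n (x0 : 'rV[R]_n) (r : R) (x : 'rV[R]_n) : 'rV[R]_n :=
  x0 + \row_i clamp r ((x - x0) 0 i).

Lemma row_clamp_lipschitz n (x0 : 'rV[R]_n) r x z :
  `|row_clamp x0 r x - row_clamp x0 r z| <= `|x - z|.
Proof.
rewrite /row_clamp opprD addrACA subrr add0r; apply: row_norm_le => // i.
rewrite !mxE; apply: le_trans (clamp_lipschitz _ _ _) _.
rewrite opprD addrACA subrr addr0.
by apply: le_trans (ler_row_norm _ i); rewrite !mxE.
Qed.

Lemma row_clamp_near n (x0 : 'rV[R]_n) r x : 0 <= r -> `|row_clamp x0 r x - x0| <= r.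
Proof.
move=> r0; rewrite /row_clamp addrAC subrr add0r; apply: row_norm_le => // i.
by rewrite mxE; have := clamp_itv ((x - x0) 0 i) r0; rewrite in_itv /= ler_norml.
Qed.

Lemma row_clamp_id n (x0 : 'rV[R]_n) r x : `|x - x0| <= r -> row_clamp x0 r x = x.
Proof.
move=> xr; rewrite /row_clamp (_ : \row_i _ = x - x0) ?subrKC//.
apply/rowP => i; rewrite mxE clamp_id// in_itv /= -ler_norml.
exact: le_trans (ler_row_norm _ _) xr.
Qed.

(** Near [x0] the partial derivatives are bounded, and the mean value theorem is applied along
    segments, which stay in the ball by convexity. Quantifying over all small [d] lets finitely many
    components share one radius. *)
Lemma locally_lipschitz n (W : set 'rV[R]_n) (F : 'rV[R]_n -> R) (x0 : 'rV[R]_n) :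
  open W -> W x0 -> times_differentiable 2 W F ->
  exists2 L, 0 <= L & \forall d \near 0^'+, forall x z,
    `|x - x0| <= d -> `|z - x0| <= d ->
    `|F x - F z| <= L * `|x - z| /\ `|F x| <= L.
Proof.
move=> oW Wx0 [dF dDF].
pose B := \sum_j (`|'D_(delta_mx 0 j) F x0| + 1).
have near1 (g : 'rV[R]_n -> R) : differentiable g x0 ->
    \forall x \near x0, `|g x| < `|g x0| + 1.
  move=> /differentiable_continuous cg; apply: cvgr_norm_lt cg _ _.
  by rewrite ltrDl.
have nD : \forall x \near x0,
    forall j, `|'D_(delta_mx 0 j) F x| < `|'D_(delta_mx 0 j) F x0| + 1.
  have H j := near1 _ (proj1 (dDF (delta_mx 0 j)) _ Wx0).
  exact: (@filter_forall _ _ _ _ (nbhs_filter x0) H).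
have nb : \forall x \near x0, [/\ W x, `|F x| < `|F x0| + 1 &
    forall j, `|'D_(delta_mx 0 j) F x| < `|'D_(delta_mx 0 j) F x0| + 1].
  by apply: filterS3 (open_nbhs_nbhs (conj oW Wx0)) (near1 F (dF _ Wx0)) nD.
exists (`|F x0| + 1 + B).
  by rewrite addr_ge0// ?addr_ge0// sumr_ge0// => i _; rewrite addr_ge0.
have /nbhs_ballP[r /= r0 br] := nb.
near=> d => x z xd zd.
have B0 : 0 <= B by rewrite sumr_ge0// => i _; rewrite addr_ge0.
have dr : d < r by near: d; exact: nbhs_right_lt.
have bd w : `|w - x0| <= d -> ball x0 r w.
  by move=> wd; rewrite -ball_normE /ball_ /= distrC; exact: le_lt_trans dr.
split; last first.
  have [_ h _] := br _ (bd _ xd).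
  by apply: le_trans (ltW h) _; rewrite lerDl.
have seg t : t \in `[0, 1] -> ball x0 r (z + t *: (x - z)).
  rewrite in_itv /= => /andP[t0 t1]; apply: bd.
  have -> : z + t *: (x - z) - x0 = t *: (x - x0) + (1 - t) *: (z - x0).
    by apply/rowP => i; rewrite !mxE; ring.
  apply: le_trans (ler_normD _ _) _; rewrite !normrZ !ger0_norm ?subr_ge0//.
  apply: (@le_trans _ _ (t * d + (1 - t) * d)).
    by apply: lerD; apply: ler_wpM2l => //; rewrite subr_ge0.
  by rewrite -mulrDl subrKC mul1r.
have [t th tE] := @mean_value R (fun t => F (z + t *: (x - z)))
   (fun t => 'D_(x - z) F (z + t *: (x - z))) 1 ltr01
   (fun t th => is_derive_line (dF _ (let: And3 h _ _ := br _ (seg t th) in h))).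
move: tE; rewrite scale1r scale0r addr0 subrKC mulr1 => ->.
have [Wt _ Bt] := br _ (seg t (subset_itv_oo_cc th)).
rewrite derive_row_basis; last exact: dF.
apply: le_trans (ler_norm_sum _ _ _) _.
apply: (@le_trans _ _ (B * `|x - z|)); last by rewrite ler_wpM2r// lerDr addr_ge0.
rewrite mulr_suml; apply: ler_sum => j _; rewrite normrM mulrC.
by apply: ler_pM => //; [exact: ltW|exact: ler_row_norm].
Unshelve. all: by end_near. Qed.

(** Bootstrapping: if [y] is [n] times differentiable, so is [F (y t)], which is the derivative of
    [y]. *)
Lemma times_differentiable_ode n k (I : set R) (W : set 'rV[R]_k)
    (F : 'rV[R]_k -> 'rV[R]_k) (y : R -> 'rV[R]_k) :
  open I -> open W -> smooth_on W F ->
  (forall t, I t -> W (y t) /\ is_derive t 1 y (F (y t))) ->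
  times_differentiable n I y.
Proof.
move=> oI oW sF yP.
have dy t : I t -> differentiable y t.
  by move=> /yP[_ [dy _]]; exact/derivable1_diffP.
elim: n => //= n IH; split=> // v.
apply: (@times_differentiable_eq _ _ _ _ _ (fun t => \matrix_(i, j) (v * F (y t) i j))) => //.
  move=> t It; have [_ [_ yE]] := yP t It.
  rewrite -[v in RHS]mulr1 (derive_dirZ (dy t It) v 1) yE.
  by apply/matrixP => i j; rewrite !mxE.
apply/times_differentiable_mxP => // i j.
rewrite (_ : (fun _ => _) = (fun t => cst v t * F (y t) i j)); last first.
  by apply/funext => t; rewrite mxE.
apply: times_differentiableM => //; first exact: times_differentiable_cst.
have IWy t : I t -> W (y t) by move=> /yP[].
have := times_differentiable_comp_mx oI oW IWy IH (sF n).
by move=> /(times_differentiable_mxP _ _ oI).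
Qed.

(** The field is frozen outside a small ball by [row_clamp], which makes it globally bounded and
    Lipschitz. By continuity the solution stays in the ball for a short time, and there the field is
    the original one. *)
Lemma smooth_ode k (W : set 'rV[R]_k) (F : 'rV[R]_k -> 'rV[R]_k) (x0 : 'rV[R]_k) :
  open W -> W x0 -> smooth_on W F ->
  exists (h : R) (y : R -> 'rV[R]_k), [/\ 0 < h, y 0 = x0 &
    forall t, t \in `]- h, h[ -> W (y t) /\ is_derive t 1 y (F (y t))].
Proof.
move=> oW Wx0 sF.
have sFi i : times_differentiable 2 W (fun x => F x 0 i).
  by have [/(_ (sF 2%N) 0 i)] := times_differentiable_mxP 2 F oW.
have lip i : exists L, 0 <= L /\ \forall d \near 0^'+, forall x z,
    `|x - x0| <= d -> `|z - x0| <= d ->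
    `|F x 0 i - F z 0 i| <= L * `|x - z| /\ `|F x 0 i| <= L.
  by have [L L0 H] := locally_lipschitz oW Wx0 (sFi i); exists L.
pose L_ i := projT1 (cid (lip i)); pose L := \sum_i L_ i.
have L_0 i : 0 <= L_ i := (projT2 (cid (lip i))).1.
have L_L i : L_ i <= L by rewrite /L (bigD1 i)//= lerDl sumr_ge0.
have L0 : 0 <= L by rewrite sumr_ge0.
have LP : \forall d \near 0^'+, forall i x z,
    `|x - x0| <= d -> `|z - x0| <= d ->
    `|F x 0 i - F z 0 i| <= L_ i * `|x - z| /\ `|F x 0 i| <= L_ i.
  exact: (@filter_forall _ _ _ _ _ (fun i => (projT2 (cid (lip i))).2)).
have /nbhs_ballP[r /= r0 br] : nbhs x0 W by exact: open_nbhs_nbhs.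
have [d [d0 dr dP]] : exists d, [/\ 0 < d, d < r & forall i x z,
    `|x - x0| <= d -> `|z - x0| <= d ->
    `|F x 0 i - F z 0 i| <= L_ i * `|x - z| /\ `|F x 0 i| <= L_ i].
  near (0 : R)^'+ => d; exists d; split; near: d => //.
    exact: nbhs_right_gt.
  exact: nbhs_right_lt.
pose G x := F (row_clamp x0 d x).
have near_x0 x : `|row_clamp x0 d x - x0| <= d by apply: row_clamp_near; exact: ltW.
have GL x z : `|G x - G z| <= L * `|x - z|.
  apply: row_norm_le => [|i]; first by rewrite mulr_ge0.
  rewrite !mxE; have [+ _] := dP i _ _ (near_x0 x) (near_x0 z).
  move=> /le_trans; apply; apply: ler_pM => //; exact: row_clamp_lipschitz.
have GK x : `|G x| <= L.
  apply: row_norm_le => // i; have [_ +] := dP i _ _ (near_x0 x) (near_x0 x).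
  by move=> /le_trans; apply.
have [h [y [h0 y0 yP]]] := picard x0 GL GK.
have cy : {for 0, continuous y}.
  apply: differentiable_continuous; apply/derivable1_diffP.
  by case: (yP 0 _) => //; rewrite in_itv /= oppr_lt0 h0.
have /nbhs_ballP[e /= e0 be] : \forall t \near 0, `|y t - x0| < d.
  move/cvgrPdist_lt: cy => /(_ d d0); apply: filterS => t.
  by rewrite y0 distrC.
exists (Num.min h e), y; split=> [|//|t]; first by rewrite lt_min h0.
rewrite in_itv /= => /andP[t1 t2].
have th : t \in `]- h, h[.
  move: t1 t2; rewrite in_itv /= lt_min => t1 /andP[-> _]; rewrite andbT.
  by apply: le_lt_trans t1; rewrite lerN2 ge_min lexx.
have tx : `|y t - x0| < d.
  apply: be; rewrite -ball_normE /ball_ /= sub0r normrN ltr_norml.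
  move: t1 t2; rewrite lt_min => t1 /andP[_ ->]; rewrite andbT.
  by apply: le_lt_trans t1; rewrite lerN2 ge_min lexx orbT.
split; last by have := yP t th; rewrite /G row_clamp_id// ltW.
by apply: br; rewrite -ball_normE /ball_ /= distrC; exact: lt_trans dr.
Unshelve. all: by end_near. Qed.

End SmoothOde.

(** * Geodesics *)

Section SecondDerivative.
Variable R : realType.

Lemma is_derive_mx (V : normedModType R) p q (f : V -> 'M[R]_(p, q)) x v
    (df : 'M[R]_(p, q)) :
  (forall i j, is_derive x v (fun y => f y i j) (df i j)) -> is_derive x v f df.
Proof.
move=> fdf.
have dv : derivable f x v by apply/derivable_mxP => i j; case: (fdf i j).
apply: DeriveDef => //; rewrite derive_mx//; apply/matrixP => i j; rewrite mxE.
by case: (fdf i j).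
Qed.

Lemma is_derive_mx_entry (V : normedModType R) p q (f : V -> 'M[R]_(p, q)) x v
    (df : 'M[R]_(p, q)) i j :
  is_derive x v f df -> is_derive x v (fun y => f y i j) (df i j).
Proof.
move=> [dv <-]; apply: DeriveDef; first by move/derivable_mxP: dv.
by rewrite derive_mx// mxE.
Qed.

(** The direction in the second term is frozen at time [t], while in the first derivative of
    [g (c s)] it moves with [s]. In the basis expansion the moving coefficients produce the term
    with the second derivative of [c]. *)
Lemma derive2_comp_scalar k (I : set R) (W : set 'rV[R]_k) (c : R -> 'rV[R]_k)
    (g : 'rV[R]_k -> R) (t : R) : open I -> open W -> I t ->
  (forall s, I s -> W (c s)) ->
  times_differentiable 2 I c -> times_differentiable 2 W g ->
  'D_1 ('D_1 (fun s => g (c s))) t =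
  'D_('D_1 ('D_1 c) t) g (c t) + 'D_('D_1 c t) ('D_('D_1 c t) g) (c t).
Proof.
move=> oI oW It cW [dc ddc] [dg ddg].
have D1 s : I s -> 'D_1 (fun s => g (c s)) s =
    \sum_i ('D_1 c s) 0 i * 'D_(delta_mx 0 i) g (c s).
  move=> Is; rewrite (derive_comp (1 : R) (dc s Is) (dg _ (cW s Is))).
  exact: derive_row_basis (dg _ (cW s Is)).
have W' : \forall y \near c t, W y by apply: open_nbhs_nbhs; split=> //; exact: cW.
have I' : \forall s \near t, I s by exact: open_nbhs_nbhs.
rewrite (near_eq_derive (1 : R) (filterS D1 I')).
set w := 'D_1 c t.
have -> : 'D_w ('D_w g) (c t) = \sum_i w 0 i * 'D_w ('D_(delta_mx 0 i) g) (c t).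
  have D2 y : W y -> 'D_w g y = \sum_i w 0 i *: 'D_(delta_mx 0 i) g y.
    by move=> Wy; exact: derive_row_basis (dg _ Wy).
  rewrite (near_eq_derive w (filterS D2 W')).
  have := @derive_sum _ _ _ k (fun i => w 0 i \*: 'D_(delta_mx 0 i) g) (c t) w.
  rewrite fct_sumE => -> => [|i].
    apply: eq_bigr => i _; rewrite deriveZ//.
    by apply: diff_derivable; have [+ _] := ddg (delta_mx 0 i); apply; exact: cW.
  apply: derivableZ; apply: diff_derivable.
  by have [+ _] := ddg (delta_mx 0 i); apply; exact: cW.
rewrite (derive_row_basis _ (dg _ (cW t It))) -big_split /=.
have dci i : is_derive t (1 : R) (fun s => ('D_1 c s) 0 i) (('D_1 ('D_1 c) t) 0 i).
  apply: is_derive_mx_entry; apply: derivableP; apply: diff_derivable.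
  by have [+ _] := ddc 1; apply.
have dgi i : is_derive t (1 : R) (fun s => 'D_(delta_mx 0 i) g (c s))
    ('D_w ('D_(delta_mx 0 i) g) (c t)).
  have [/(_ _ (cW t It)) d _] := ddg (delta_mx 0 i).
  rewrite -(derive_comp (1 : R) (dc t It) d); apply: derivableP.
  by apply: diff_derivable; exact: differentiable_comp (dc t It) d.
have := @derive_sum _ _ _ k
  (fun i => (fun s => ('D_1 c s) 0 i) * (fun s => 'D_(delta_mx 0 i) g (c s))) t 1.
rewrite fct_sumE => -> => [|i]; last first.
  by apply: derivableM; [case: (dci i)|case: (dgi i)].
apply: eq_bigr => i _; have [h1 h2] := dci i; have [h3 h4] := dgi i.
rewrite (deriveM h1 h3) h2 h4 addrC; congr (_ + _); exact: mulrC.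
Qed.

Lemma derive2_comp k p q (I : set R) (W : set 'rV[R]_k) (c : R -> 'rV[R]_k)
    (g : 'rV[R]_k -> 'M[R]_(p, q)) (t : R) : open I -> open W -> I t ->
  (forall s, I s -> W (c s)) ->
  times_differentiable 2 I c -> times_differentiable 2 W g ->
  (fun s => g (c s))^`(2)%classic t =
  'D_(c^`(2)%classic t) g (c t) + 'D_(c^`()%classic t) ('D_(c^`()%classic t) g) (c t).
Proof.
move=> oI oW It cW d2c d2g; rewrite !derive1nS !derive1n0.
have D1 (E : normedModType R) (f : R -> E) : f^`()%classic = 'D_1 f.
  by apply/funext => s; rewrite derive1E.
rewrite !D1; apply/matrixP => i j.
have [/(_ d2g i j) d2gij _] := times_differentiable_mxP 2 g oW.
have d2gc := times_differentiable_comp_mx oI oW cW d2c d2g.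
have [dg ddg] := d2g; have [dgc ddgc] := d2gc.
have Wct := cW t It.
have I' : \forall s \near t, I s by exact: open_nbhs_nbhs.
have W' : \forall y \near c t, W y by exact: open_nbhs_nbhs.
set w := 'D_1 c t; set a := 'D_1 ('D_1 c) t.
have EA : 'D_a g (c t) i j = 'D_a (fun y => g y i j) (c t).
  exact: derive_mx_entry (dg _ Wct).
have EB : 'D_w ('D_w g) (c t) i j = 'D_w ('D_w (fun y => g y i j)) (c t).
  rewrite (derive_mx_entry _ _ _ (proj1 (ddg _) _ Wct)).
  apply: (near_eq_derive w); apply: filterS W' => y Wy.
  exact: derive_mx_entry (dg _ Wy).
have EC : 'D_1 ('D_1 (fun s => g (c s))) t i j = 'D_1 ('D_1 (fun s => g (c s) i j)) t.
  rewrite (derive_mx_entry _ _ _ (proj1 (ddgc 1) _ It)).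
  apply: (near_eq_derive (1 : R)); apply: filterS I' => s Is.
  exact: derive_mx_entry (dgc _ Is).
have addE (X Y : 'M[R]_(p, q)) : (X + Y) i j = X i j + Y i j by rewrite mxE.
apply: (etrans EC); apply: (etrans _ (esym (addE _ _))).
apply: (etrans _ (esym (congr2 +%R EA EB))).
exact: derive2_comp_scalar d2c d2gij.
Qed.

End SecondDerivative.

Section Geodesics.
Variables (R : realType) (M : topologicalType) (S : complex_surface R M).
Local Notation V := ('C2 R).
Implicit Types (phi : chart R M) (nabla : affine_connection S).

Lemma linear_fun_sum (U W : lmodType R) (f : U -> W) n (a : 'I_n -> R) (w : 'I_n -> U) :
  linear f -> f (\sum_i a i *: w i) = \sum_i a i *: f (w i).
Proof.
move=> lf.
have f0 : f 0 = 0 by have := lf (-1) 0 0; rewrite scaler0 addr0 scaleN1r addNr.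
apply: (big_ind2 (fun x y => f x = y)) => // [x1 x2 y1 y2 <- <-|i _].
  by rewrite -[x1]scale1r lf !scale1r.
exact: scalable_linear lf _ _.
Qed.

(** Smoothness of [christoffel] is given for constant arguments only; this expansion extends it to
    arguments that vary, such as a velocity. *)
Lemma christoffel_basis nabla phi x (u v : V) : atlas S phi -> cod phi x ->
  christoffel nabla phi x u v =
  \sum_i \sum_j (u 0 i * v 0 j) *: christoffel nabla phi x (delta_mx 0 i) (delta_mx 0 j).
Proof.
move=> aphi xphi.
rewrite {1}(row_sum_delta u) (linear_fun_sum _ _ (christoffel_linl nabla aphi xphi v)).
apply: eq_bigr => i _.
rewrite {1}(row_sum_delta v) (linear_fun_sum _ _ (christoffel_linr nabla aphi xphi _)).
by rewrite scaler_sumr; apply: eq_bigr => j _; rewrite scalerA.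
Qed.

(** The geodesic spray: the second-order equation as a first-order system, with the position in the
    left half of the row and the velocity in the right half. *)
Definition geodesic_field nabla phi (s : 'rV[R]_((2 + 2) + (2 + 2))) :=
  row_mx (rsubmx s) (- christoffel nabla phi (lsubmx s) (rsubmx s) (rsubmx s)).

Definition phase_domain phi : set 'rV[R]_((2 + 2) + (2 + 2)) :=
  [set s | cod phi (lsubmx s)].

Lemma phase_domain_open phi : open (phase_domain phi).
Proof.
apply: open_comp; last exact: cod_open.
by move=> s _; apply: differentiable_continuous; exact: differentiable_lsubmx.
Qed.

Lemma geodesic_field_smooth nabla phi : atlas S phi ->
  smooth_on (phase_domain phi) (geodesic_field nabla phi).
Proof.
move=> aphi n; have oW := @phase_domain_open phi.
have coordW j := times_differentiable_coord n j oW.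
apply/times_differentiable_mxP => // i j; rewrite (ord1 i) {i}.
case: (split_ordP j) => k ->.
  apply: times_differentiable_eq (coordW (rshift _ k)) => // s _.
  by rewrite row_mxEl mxE.
pose G a b (s : 'rV[R]_((2 + 2) + (2 + 2))) :=
  (christoffel nabla phi (lsubmx s) (delta_mx 0 a) (delta_mx 0 b)) 0 k.
have dG a b : times_differentiable n (phase_domain phi) (G a b).
  have oc : open (cod phi) by exact: cod_open.
  have [/(_ (christoffel_smooth nabla aphi (delta_mx 0 a) (delta_mx 0 b) n) 0 k) H _] :=
    times_differentiable_mxP n (fun x => christoffel nabla phi x (delta_mx 0 a) (delta_mx 0 b)) oc.
  apply: (@times_differentiable_comp _ n _ _ _ (cod phi) (fun s => lsubmx s)) H => //.
  apply/times_differentiable_mxP => // i l.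
  apply: times_differentiable_eq (coordW (lshift _ l)) => // s _.
  by rewrite mxE (ord1 i).
apply: (@times_differentiable_eq _ _ _ n _
    (fun s : 'rV[R]_((2 + 2) + (2 + 2)) => \sum_a \sum_b
    cst (-1 : R) s * (s 0 (rshift (2 + 2) a) * s 0 (rshift (2 + 2) b) * G a b s))) => //.
  move=> s sW; rewrite row_mxEr mxE christoffel_basis// summxE -sumrN.
  apply: eq_bigr => a _; rewrite summxE -sumrN; apply: eq_bigr => b _.
  by rewrite !mxE /= mulN1r.
apply: times_differentiable_sum => // a; apply: times_differentiable_sum => // b.
apply: times_differentiableM => //; first exact: times_differentiable_cst.
by do 2 apply: times_differentiableM => //.
Qed.

End Geodesics.

Section GeneralisedGeodesics.
Variables (R : realType) (M : topologicalType) (S : complex_surface R M).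
Local Notation V := ('C2 R).
Implicit Types (phi : chart R M) (nabla : affine_connection S).

Lemma geodesic_exists nabla phi (x v : V) : atlas S phi -> cod phi x -> v != 0 ->
  exists (h : R) (c : R -> V), [/\ 0 < h, c 0 = x, c^`()%classic 0 = v,
    smooth_on [set` `]- h, h[] c &
    forall t, t \in `]- h, h[ -> [/\ cod phi (c t), c^`()%classic t != 0 &
      c^`(2)%classic t
      + christoffel nabla phi (c t) (c^`()%classic t) (c^`()%classic t) = 0]].
Proof.
move=> aphi xphi v0.
pose F := geodesic_field nabla phi.
have oW := @phase_domain_open _ _ phi.
have sF := geodesic_field_smooth nabla aphi.
have Wxv : phase_domain phi (row_mx x v) by rewrite /phase_domain /= row_mxKl.
have [h [y [h0 y0 yP]]] := smooth_ode oW Wxv sF.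
pose c : R -> V := fun s => lsubmx (y s).
have dl t : t \in `]- h, h[ -> is_derive t 1 c (rsubmx (y t)).
  move=> /yP[_ dy]; apply: is_derive_mx => i j; rewrite (ord1 i).
  have := is_derive_mx_entry 0 (lshift _ j) dy.
  rewrite row_mxEl.
  by rewrite (_ : (fun s => y s 0 _) = (fun s => c s 0 j))//;
    apply/funext => s; rewrite mxE.
have dr t : t \in `]- h, h[ -> is_derive t 1 (fun s => rsubmx (y s))
    (- christoffel nabla phi (lsubmx (y t)) (rsubmx (y t)) (rsubmx (y t)) : V).
  move=> /yP[_ dy]; apply: is_derive_mx => i j; rewrite (ord1 i).
  have := is_derive_mx_entry 0 (rshift _ j) dy.
  rewrite row_mxEr.
  by rewrite (_ : (fun s => y s 0 _) = (fun s => rsubmx (y s) 0 j))//;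
    apply/funext => s; rewrite mxE.
have h00 : 0 \in `]- h, h[ by rewrite in_itv /= oppr_lt0 h0.
have r0 : rsubmx (y 0) = v by rewrite y0 row_mxKr.
have cr : {for 0, continuous (fun s => rsubmx (y s))}.
  apply: differentiable_continuous; apply/derivable1_diffP.
  by case: (dr 0 h00).
have /nbhs_ballP[e /= e0 be] : \forall t \near 0, `|v - rsubmx (y t)| < `|v|.
  by move/cvgrPdist_lt: cr => /(_ `|v|); rewrite r0; apply; rewrite normr_gt0.
(* The interval is shortened so that the velocity, equal to [v] at time 0, stays nonzero and the
   curve is immersed. *)
pose k := Num.min h e.
have k0 : 0 < k by rewrite lt_min h0.
have kh t : t \in `]- k, k[ -> t \in `]- h, h[.
  rewrite !in_itv /= => /andP[t1]; rewrite lt_min => /andP[-> _]; rewrite andbT.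
  by apply: le_lt_trans t1; rewrite lerN2 ge_min lexx.
have ke t : t \in `]- k, k[ -> rsubmx (y t) != 0.
  rewrite !in_itv /= => /andP[t1]; rewrite lt_min => /andP[_ t2].
  have /be : ball 0 e t.
    rewrite -ball_normE /ball_ /= sub0r normrN ltr_norml t2 andbT.
    by apply: le_lt_trans t1; rewrite lerN2 ge_min lexx orbT.
  by apply: contraTneq => ->; rewrite subr0 ltxx.
have dl1 t : t \in `]- h, h[ -> c^`()%classic t = rsubmx (y t).
  by move=> /dl[_ <-]; rewrite derive1E.
have dl2 t : t \in `]- h, h[ -> c^`(2)%classic t =
    - christoffel nabla phi (lsubmx (y t)) (rsubmx (y t)) (rsubmx (y t)).
  move=> th; have [_ <-] := dr t th; rewrite derive1nS derive1n1 derive1E.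
  apply: near_eq_derive; apply: filterS (near_in_itvoo th) => s; exact: dl1.
exists k, c; split=> //.
- by rewrite /c y0 row_mxKl.
- by rewrite dl1.
- move=> n; apply/times_differentiable_mxP; first exact: itv_open.
  move=> i j; have yP' t : [set` `]- k, k[] t ->
      phase_domain phi (y t) /\ is_derive t 1 y (F (y t)).
    by move=> /kh; exact: yP.
  have := times_differentiable_ode n (itv_open (- k) k) oW sF yP'.
  move=> /(times_differentiable_mxP _ _ (itv_open (- k) k))/(_ i (lshift _ j)).
  by apply: times_differentiable_eq => [|t _]; [exact: itv_open|rewrite mxE].
- move=> t tk; have th := kh t tk; have /= e2 := dl2 t th.
  rewrite e2 (dl1 t th) addNr; split=> //.
  + by have [] := yP t th.
  + exact: ke.
Qed.

End GeneralisedGeodesics.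

(** * Transport of geodesics between charts *)

Section Charts.
Variables (R : realType) (M : topologicalType) (S : complex_surface R M).
Local Notation V := ('C2 R).
Implicit Types (phi psi : chart R M) (nabla : affine_connection S).

Lemma overlap_open phi psi : open (overlap phi psi).
Proof.
rewrite openE => _ [p [phip psip] <-]; rewrite /interior.
have cphip : cod phi (coord phi p) by exists p.
have n1 : nbhs (coord phi p) (cod phi).
  by apply: open_nbhs_nbhs; split=> //; exact: cod_open.
have n2 : \forall x \near coord phi p, dom psi (coord_inv phi x).
  apply: (coord_inv_continuous cphip); rewrite coordK//.
  by apply: open_nbhs_nbhs; split=> //; exact: dom_open.
apply: filterS2 n1 n2 => _ [q phiq <-]; rewrite coordK// => psiq.
by exists q.
Qed.

Lemma transition_overlap phi psi x :
  overlap phi psi x -> overlap psi phi (transition phi psi x).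
Proof. by move=> [p [phip psip] <-]; rewrite /transition coordK//; exists p. Qed.

Lemma transitionK phi psi x :
  overlap phi psi x -> transition psi phi (transition phi psi x) = x.
Proof. by move=> [p [phip psip] <-]; rewrite /transition !coordK. Qed.

Lemma transition_smooth phi psi : atlas S phi -> atlas S psi ->
  smooth_on (overlap phi psi) (transition phi psi).
Proof. by move=> aphi apsi; have [[]] := atlas_compatible aphi apsi. Qed.

(** Differentiating [transitionK] gives a left inverse of the derivative of the transition. *)
Lemma transition_derive_inj phi psi x u : atlas S phi -> atlas S psi ->
  overlap phi psi x -> 'D_u (transition phi psi) x = 0 -> u = 0.
Proof.
move=> aphi apsi ox D0.
have [d1 _] := transition_smooth aphi apsi 1.
have [d2 _] := transition_smooth apsi aphi 1.
have : 'D_u (transition psi phi \o transition phi psi) x = u.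
  rewrite -[RHS](derive_id x u); apply: near_eq_derive.
  have : \forall y \near x, overlap phi psi y.
    by apply: open_nbhs_nbhs; split=> //; exact: overlap_open.
  by apply: filterS => y; exact: transitionK.
rewrite (derive_comp u (d1 _ ox) (d2 _ (transition_overlap ox))) D0.
by rewrite derive0.
Qed.

Lemma wedge3_0l (b c : V) f : wedge3 0 b c f = 0.
Proof.
rewrite /wedge3 (expand_det_row _ 0) big1// => j _.
by rewrite mxE (_ : tnth _ 0 = 0) ?mxE ?mul0r.
Qed.

(** The acceleration in another chart is the image of the acceleration in [phi] under the derivative
    of the transition, so it vanishes as well. *)
Lemma generalised_geodesic_chart nabla phi (h : R) (c : R -> V) :
  atlas S phi -> smooth_on [set` `]- h, h[] c ->
  (forall t, t \in `]- h, h[ -> [/\ cod phi (c t), c^`()%classic t != 0 &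
      c^`(2)%classic t
      + christoffel nabla phi (c t) (c^`()%classic t) (c^`()%classic t) = 0]) ->
  generalised_geodesic nabla [set` `]- h, h[] (fun t => coord_inv phi (c t)).
Proof.
move=> aphi sc cP; set I := [set` _]; set gamma := fun t => _.
have oI : open I by exact: itv_open.
have dc t : I t -> differentiable c t by have [+ _] := sc 1; apply.
have cgamma t : I t -> {for t, continuous gamma}.
  move=> It; apply: (@continuous_comp _ _ _ c (coord_inv phi)).
    exact: differentiable_continuous (dc t It).
  by apply: coord_inv_continuous; have [] := cP t It.
pose I' psi := I `&` gamma @^-1` dom psi.
have oI' psi : open (I' psi).
  rewrite openE => t [It psit]; rewrite /interior.
  have n1 : nbhs t I by exact: open_nbhs_nbhs.
  have n2 : nbhs t (gamma @^-1` dom psi).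
    apply: (cgamma t It).
    by apply: open_nbhs_nbhs; split=> //; exact: dom_open.
  exact: filterI.
have ov psi t : I' psi t -> overlap phi psi (c t).
  move=> [It psit]; have [[p phip cE] _ _] := cP t It; exists p => //.
  by split=> //; move: psit; rewrite /gamma /= -cE coordK.
have sc' psi : smooth_on (I' psi) c.
  by move=> n; apply: times_differentiable_sub (sc n) => t [].
have stau psi : atlas S psi -> smooth_on (overlap phi psi) (transition phi psi).
  by move=> apsi; exact: transition_smooth.
have vel psi t : atlas S psi -> I' psi t ->
    velocity psi gamma t = 'D_(c^`()%classic t) (transition phi psi) (c t).
  move=> apsi It; have [dtau _] := stau psi apsi 1.
  by rewrite /velocity !derive1E -(derive_comp (1 : R) (dc t It.1) (dtau _ (ov _ _ It))).
split.
  split=> //; first by split=> //; exact: interval_is_interval.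
  move=> psi apsi; split=> [n|t It psit].
    exact: times_differentiable_comp_mx (oI' psi) (@overlap_open phi psi) (ov psi)
      (sc' psi n) (stau psi apsi n).
  rewrite vel//; have [_ + _] := cP t It; apply: contraNneq.
  by move=> /(transition_derive_inj aphi apsi (ov psi t (conj It psit))) ->.
move=> psi t apsi It psit f.
have I't : I' psi t by [].
suff -> : acceleration nabla psi gamma t = 0 by exact: wedge3_0l.
rewrite /acceleration vel//.
have -> : (curve_in psi gamma)^`(2)%classic t =
    'D_(c^`(2)%classic t) (transition phi psi) (c t)
    + 'D_(c^`()%classic t) ('D_(c^`()%classic t) (transition phi psi)) (c t).
  exact: derive2_comp (oI' psi) (@overlap_open phi psi) I't (ov psi)
      (sc' psi 2) (stau psi apsi 2).
(* The transformation law trades the second derivative of the transition and the Christoffel term of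
   [psi] for the Christoffel term of [phi]. *)
have /= E := christoffel_transition nabla aphi apsi (ov psi t I't)
  (c^`()%classic t) (c^`()%classic t).
rewrite -addrA E.
have [dtau _] := stau psi apsi 1; have dtauc := dtau _ (ov psi t I't).
have [_ _ c0] := cP t It.
by rewrite -[X in X + _]scale1r -(derive_dirP dtauc) scale1r c0 derive0.
Qed.

End Charts.

(** * Projective invariance *)

Lemma det_mx33 (R : comRingType) (m : nat -> nat -> R) :
  \det (\matrix_(i < 3, j < 3) m i j) =
    m 0 0 * (m 1 1 * m 2 2 - m 1 2 * m 2 1)
  - m 0 1 * (m 1 0 * m 2 2 - m 1 2 * m 2 0)
  + m 0 2 * (m 1 0 * m 2 1 - m 1 1 * m 2 0).
Proof.
rewrite (expand_det_row _ ord0) !big_ord_recl big_ord0 /cofactor.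
rewrite !(expand_det_row _ (ord0 : 'I_2)) !big_ord_recl !big_ord0 /cofactor !det_mx11.
rewrite !mxE /= /bump /=; ring.
Qed.

Section ProjectiveInvariance.
Variables (R : realType) (M : topologicalType) (S : complex_surface R M).
Local Notation V := ('C2 R).
Local Notation C := R[i].
Implicit Types (phi : chart R M) (nabla : complex_connection S).

Lemma wedge3E (a b c : V) (p q r : 'I_(2 + 2)) :
  wedge3 a b c (fun s : 'I_3 => nth p [:: p; q; r] s) =
    a 0 p * (b 0 q * c 0 r - b 0 r * c 0 q)
  - a 0 q * (b 0 p * c 0 r - b 0 r * c 0 p)
  + a 0 r * (b 0 p * c 0 q - b 0 q * c 0 p).
Proof.
rewrite -(det_mx33 (fun i j => (nth 0 [:: a; b; c] i) 0 (nth p [:: p; q; r] j))).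
by congr (\det _); apply/matrixP => i j; rewrite !mxE (tnth_nth 0).
Qed.

(* (a, 0) is the vector with real complex coordinates a, and the conclusion says
   that w is a complex multiple of it. *)
Lemma wedge3_real_complex_span (w : V) (a : 'rV[R]_2) : a != 0 ->
  (forall f, wedge3 w (row_mx a 0) (J0 (row_mx a 0)) f = 0) ->
  dz 0 w * (a 0 1)%:C%C = dz 1 w * (a 0 0)%:C%C.
Proof.
move=> a0 W.
(* The coordinates (x^1, x^2, y^k) give the real part of the relation and (x^k, y^1, y^2) the
   imaginary part, each multiplied by the nonzero [a 0 k]. *)
have [k ak] : exists k, a 0 k != 0 by apply/rV0Pn.
have := W (fun s : 'I_3 => nth (lshift 2 0) [:: lshift 2 0; lshift 2 1; rshift 2 k] s).
have := W (fun s : 'I_3 => nth (lshift 2 k) [:: lshift 2 k; rshift 2 0; rshift 2 1] s).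
rewrite !wedge3E /J0 row_mxKl row_mxKr oppr0 !row_mxEl !row_mxEr !mxE.
rewrite !(mulr0, mul0r, subr0, sub0r, addr0, add0r) => h1 h2.
have e1 : w 0 (lshift 2 0) * a 0 1 = w 0 (lshift 2 1) * a 0 0.
  by apply: (mulIf ak); lra.
have e2 : w 0 (rshift 2 0) * a 0 1 = w 0 (rshift 2 1) * a 0 0.
  by apply: (mulIf ak); lra.
rewrite /dz !mxE; apply/eqP; rewrite eq_complex /= !(mulr0, subr0, addr0, add0r).
by rewrite e1 e2 !eqxx.
Qed.

Lemma curve_in_coord_inv phi (h : R) (c : R -> V) t :
  (forall t, t \in `]- h, h[ -> cod phi (c t)) -> t \in `]- h, h[ ->
  curve_in phi (fun t => coord_inv phi (c t)) t = c t.
Proof. by move=> cod_c /cod_c; rewrite /curve_in => -[p phip <-] /=; rewrite coordK. Qed.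

(** Along the [nabla]-geodesic with initial velocity [v] the second derivative is minus the [nabla]
    term, so its [nabla']-acceleration at [x] is the difference of the two Christoffel terms. *)
Lemma equivalent_difference nabla nabla' phi (x v : V) f :
  complex_projectively_equivalent nabla nabla' -> atlas S phi -> cod phi x ->
  v != 0 ->
  wedge3 (christoffel nabla' phi x v v - christoffel nabla phi x v v) v (J0 v) f = 0.
Proof.
move=> eqv aphi xphi v0.
have [h [c [h0 c0 c'0 sc cP]]] := geodesic_exists nabla aphi xphi v0.
have [_ G] := (eqv _ _).1 (generalised_geodesic_chart aphi sc cP).
have h00 : 0 \in `]- h, h[ by rewrite in_itv /= oppr_lt0 h0.
have domx : dom phi (coord_inv phi (c 0)).
  by rewrite c0; case: xphi => p phip <-; rewrite coordK.
have {G} := G phi 0 aphi h00 domx f.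
set gamma := fun t => coord_inv phi (c t).
(* The curve read in [phi] is known to be [c] only on the interval, so derivatives are compared
   through equality near a point. *)
have curveE t : t \in `]- h, h[ -> curve_in phi gamma t = c t.
  by apply: curve_in_coord_inv => // s /cP[].
have velE t : t \in `]- h, h[ -> velocity phi gamma t = c^`()%classic t.
  move=> th; rewrite /velocity !derive1E; apply: near_eq_derive.
  by apply: filterS (near_in_itvoo th); exact: curveE.
have accE : (curve_in phi gamma)^`(2)%classic 0 = c^`(2)%classic 0.
  rewrite !derive1nS !derive1n0 derive1E [RHS]derive1E; apply: near_eq_derive.
  by apply: filterS (near_in_itvoo h00); exact: velE.
have v0E : velocity phi gamma 0 = v by rewrite (velE 0 h00).
have accE' : acceleration nabla' phi gamma 0 =
    christoffel nabla' phi x v v - christoffel nabla phi x v v.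
  have [_ _] := cP 0 h00; rewrite c'0 c0 => /eqP; rewrite addr_eq0 => /eqP c''0.
  rewrite /acceleration v0E (curveE 0 h00) c0 addrC; congr (_ + _).
  exact: etrans accE c''0.
by rewrite accE' v0E.
Qed.

End ProjectiveInvariance.

Lemma ord2P (i : 'I_2) : i = 0 \/ i = 1.
Proof. by case: i => -[|[|//]] ?; [left|right]; exact: val_inj. Qed.

Lemma sum_ord2 (K : nmodType) (f : 'I_2 -> K) : \sum_i f i = f 0 + f 1.
Proof.
rewrite !big_ord_recl big_ord0 addr0.
by congr (f _ + f _); exact: val_inj.
Qed.

Section Thomas.
Variables (R : realType) (M : topologicalType) (S : complex_surface R M).
Local Notation V := ('C2 R).
Local Notation C := R[i].
Implicit Types (phi : chart R M) (nabla : complex_connection S).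

Lemma dzD (i : 'I_2) (u v : V) : dz i (u + v) = dz i u + dz i v.
Proof. by apply/eqP; rewrite eq_complex /dz !mxE /= !eqxx. Qed.

Lemma dzZ (i : 'I_2) (a : R) (u : V) : dz i (a *: u) = a%:C%C * dz i u.
Proof.
by apply/eqP; rewrite eq_complex /dz !mxE /= !(mul0r, subr0, addr0) !eqxx.
Qed.

Lemma dzB (i : 'I_2) (u v : V) : dz i (u - v) = dz i u - dz i v.
Proof. by apply/eqP; rewrite eq_complex /dz !mxE /= !eqxx. Qed.

Lemma i_squared : 'i%C * 'i%C = -1 :> C.
Proof. by rewrite -expr2 sqr_i. Qed.

Lemma christoffel_J0l nabla phi x (u v : V) : atlas S phi -> cod phi x ->
  christoffel nabla phi x (J0 u) v = J0 (christoffel nabla phi x u v).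
Proof.
move=> aphi xphi; have tf := complex_connection_torsion_free nabla aphi xphi.
by rewrite tf (complex_connection_J_parallel nabla aphi xphi) tf.
Qed.

(** Torsion-freeness carries complex linearity from the second argument to the first, so the four
    terms of [eval_dzdz] coincide. *)
Lemma complex_christoffelE nabla phi (i j k : 'I_2) x : atlas S phi -> cod phi x ->
  complex_christoffel nabla phi i j k x = dz i (christoffel nabla phi x (ex _ j) (ex _ k)).
Proof.
move=> aphi xphi; rewrite /complex_christoffel /eval_dzdz.
rewrite !christoffel_J0l// !(complex_connection_J_parallel nabla aphi xphi) !dz_J0.
set b := dz i _; move: b => b.
have i2 := i_squared; move: 'i%C i2 => I i2.
by field: i2.
Qed.

Lemma complex_christoffel_sym nabla phi (i j k : 'I_2) x : atlas S phi -> cod phi x ->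
  complex_christoffel nabla phi i j k x = complex_christoffel nabla phi i k j x.
Proof.
move=> aphi xphi; rewrite !complex_christoffelE//.
by rewrite (complex_connection_torsion_free nabla aphi xphi).
Qed.

Lemma christoffel_real_direction nabla phi x i (s t : R) : atlas S phi -> cod phi x ->
  let v := s *: ex R 0 + t *: ex R 1 in
  dz i (christoffel nabla phi x v v) =
    s%:C%C ^+ 2 * complex_christoffel nabla phi i 0 0 x
  + 2 * s%:C%C * t%:C%C * complex_christoffel nabla phi i 0 1 x
  + t%:C%C ^+ 2 * complex_christoffel nabla phi i 1 1 x.
Proof.
move=> aphi xphi v; rewrite !complex_christoffelE//.
have ll w := christoffel_linl nabla aphi xphi w.
have lr w := christoffel_linr nabla aphi xphi w.
have llZ a u w : christoffel nabla phi x (a *: u) w = a *: christoffel nabla phi x u w.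
  exact: scalable_linear (ll w) _ _.
have lrZ a u w : christoffel nabla phi x w (a *: u) = a *: christoffel nabla phi x w u.
  exact: scalable_linear (lr w) _ _.
rewrite /v ll !lr !llZ !lrZ.
rewrite (complex_connection_torsion_free nabla aphi xphi (ex R 1) (ex R 0)).
by rewrite !(dzD, dzZ); ring.
Qed.

(** The difference of two equivalent connections has the form delta^i_j q_k + delta^i_k q_j. In
    complex dimension 2 its trace is 3 q_j, so the correction with factor 1/3 in [Pi3] removes
    it. *)
Lemma Pi3_projective_invariant nabla nabla' phi (i j k : 'I_2) x :
  complex_projectively_equivalent nabla nabla' -> atlas S phi -> cod phi x ->
  Pi3 nabla phi i j k x = Pi3 nabla' phi i j k x.
Proof.
move=> eqv aphi xphi.
pose a i j k := complex_christoffel nabla' phi i j k x - complex_christoffel nabla phi i j k x.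
have rel (s t : R) : (s != 0) || (t != 0) ->
    (s%:C%C ^+ 2 * a 0 0 0 + 2 * s%:C%C * t%:C%C * a 0 0 1 + t%:C%C ^+ 2 * a 0 1 1) * t%:C%C =
    (s%:C%C ^+ 2 * a 1 0 0 + 2 * s%:C%C * t%:C%C * a 1 0 1 + t%:C%C ^+ 2 * a 1 1 1) * s%:C%C.
  move=> st; pose al : 'rV[R]_2 := \row_j if j == 0 then s else t.
  have vE : row_mx al 0 = s *: ex R 0 + t *: ex R 1.
    rewrite /ex !scale_row_mx add_row_mx !scaler0 addr0; congr row_mx.
    apply/rowP => l; rewrite !mxE /=.
    by case: l => -[|[|//]] ? /=; rewrite ?(mulr1, mulr0, addr0, add0r).
  have al0 : al != 0.
    case/orP: st => h; apply: contra h => /eqP/rowP e.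
      by have := e 0; rewrite !mxE /= => ->.
    by have := e 1; rewrite !mxE /= => ->.
  have v0 : row_mx al 0 != 0 :> V.
    by apply: contra al0 => /eqP e; rewrite -(row_mxKl al (0 : 'rV[R]_2)) e linear0.
  have := wedge3_real_complex_span al0
    (fun f => equivalent_difference f eqv aphi xphi v0).
  rewrite !dzB vE !christoffel_real_direction// !mxE /= => e.
  by apply: (etrans _ (etrans e _)); rewrite /a; ring.
(* a(v, v) in C v for v = (1, 0), (0, 1), (1, 1), (1, -1) forces
   a^i_jk = delta^i_j q_k + delta^i_k q_j. *)
have r1 := rel 1 0; have r2 := rel 0 1; have r3 := rel 1 1; have r4 := rel 1 (-1).
have {}r1 : a 1 0 0 = 0.
  move: r1; rewrite oner_neq0 => /(_ isT); rewrite rmorph1 rmorph0 => e.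
  by apply: (etrans _ (etrans (esym e) _)); ring.
have {}r2 : a 0 1 1 = 0.
  move: r2; rewrite oner_neq0 orbT => /(_ isT); rewrite rmorph1 rmorph0 => e.
  by apply: (etrans _ (etrans e _)); ring.
move: r3 r4; rewrite oner_neq0 => /(_ isT) + /(_ isT).
rewrite rmorphN1 rmorph1 r1 r2 => r3 r4.
(* Half the difference, and below half the sum, of the relations for (1, 1) and (1, -1). *)
have {}r5 : a 0 0 0 = 2 * a 1 0 1.
  have e := congr2 (fun p q => (p - q) / 2) r3 r4.
  by apply: (etrans _ (etrans e _)); field.
have {}r6 : a 1 1 1 = 2 * a 0 0 1.
  have e := congr2 (fun p q => (p + q) / 2) r3 r4.
  by apply: (etrans _ (etrans (esym e) _)); field.
have aE i' j' k' : complex_christoffel nabla' phi i' j' k' x =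
   complex_christoffel nabla phi i' j' k' x + a i' j' k' by rewrite /a subrKC.
have a10 l : a l 1 0 = a l 0 1 by rewrite /a !(complex_christoffel_sym _ _ 1)//.
rewrite /Pi3 !sum_ord2 !aE.
case: (ord2P i) => ->; case: (ord2P j) => ->; case: (ord2P k) => ->;
  rewrite ?a10 ?r1 ?r2 ?r5 ?r6 /=; by field.
Qed.

End Thomas.

(** * Wirtinger derivatives *)

Section ComplexCalculus.
Variable R : realType.
Local Notation V := ('C2 R).
Local Notation C := R[i].
Implicit Types (f g : V -> C) (x u v : V).

Definition csmooth (U : set V) f :=
  smooth_on U (fun y => complex.Re (f y)) /\ smooth_on U (fun y => complex.Im (f y)).

Variable U : set V.
Hypothesis oU : open U.

Lemma smooth_on_derive (h : V -> R) v : smooth_on U h -> smooth_on U ('D_v h).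
Proof. by move=> sh n; have [_] := sh n.+1; apply. Qed.

Lemma smooth_on_diff (h : V -> R) x : U x -> smooth_on U h -> differentiable h x.
Proof. by move=> Ux /(_ 1%N)[+ _]; apply. Qed.

Lemma smooth_on_derivable (h : V -> R) x v : U x -> smooth_on U h -> derivable h x v.
Proof. by move=> Ux sh; apply: diff_derivable; exact: smooth_on_diff. Qed.

Lemma csmooth_eq f g : (forall x, U x -> f x = g x) -> csmooth U f -> csmooth U g.
Proof.
by move=> fg [sr si]; split=> n;
  [apply: times_differentiable_eq (sr n)|apply: times_differentiable_eq (si n)] => // x Ux;
  rewrite fg.
Qed.

Lemma csmooth_cst (z : C) : csmooth U (fun _ => z).
Proof. by split=> n; exact: times_differentiable_cst. Qed.

Lemma csmoothD f g : csmooth U f -> csmooth U g -> csmooth U (fun y => f y + g y).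
Proof.
move=> [fr fi] [gr gi]; split=> n.
- apply: times_differentiable_eq (times_differentiableD oU (fr n) (gr n)) => // x _.
  by rewrite fctE raddfD.
- apply: times_differentiable_eq (times_differentiableD oU (fi n) (gi n)) => // x _.
  by rewrite fctE raddfD.
Qed.

Lemma csmoothM f g : csmooth U f -> csmooth U g -> csmooth U (fun y => f y * g y).
Proof.
move=> [fr fi] [gr gi]; split=> n.
- have d1 := times_differentiableM oU (fr n) (gr n).
  have d2 := times_differentiableM oU (times_differentiable_cst n U (-1 : R))
     (times_differentiableM oU (fi n) (gi n)).
  apply: times_differentiable_eq (times_differentiableD oU d1 d2) => // x _.
  by rewrite fctE /= mulN1r; case: (f x) (g x) => ? ? [].
- have d1 := times_differentiableM oU (fr n) (gi n).
  have d2 := times_differentiableM oU (fi n) (gr n).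
  apply: times_differentiable_eq (times_differentiableD oU d1 d2) => // x _.
  by rewrite fctE /=; case: (f x) (g x) => ? ? [].
Qed.

Lemma csmoothB f g : csmooth U f -> csmooth U g -> csmooth U (fun y => f y - g y).
Proof.
move=> sf sg; apply: csmooth_eq (csmoothD sf (csmoothM (csmooth_cst (-1)) sg)) => x _.
by rewrite mulN1r.
Qed.

Lemma csmooth_sum n (f : 'I_n -> V -> C) : (forall i, csmooth U (f i)) ->
  csmooth U (fun y => \sum_i f i y).
Proof.
move=> sf; rewrite -fct_sumE; elim/big_ind: _ => // [|g h sg sh].
  exact: csmooth_cst.
exact: csmoothD.
Qed.

Lemma csmooth_cderive f v : csmooth U f -> csmooth U (cderive v f).
Proof. by move=> [fr fi]; split; exact: smooth_on_derive. Qed.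

Lemma csmooth_wirtinger f k : csmooth U f -> csmooth U (wirtinger k f).
Proof.
move=> sf; apply: csmoothM; first exact: csmooth_cst.
apply: csmoothB; first exact: csmooth_cderive.
by apply: csmoothM; [exact: csmooth_cst|exact: csmooth_cderive].
Qed.

Lemma cderive_near f g x v : U x -> (forall y, U y -> f y = g y) ->
  cderive v f x = cderive v g x.
Proof.
move=> Ux fg; have nU : nbhs x U by exact: open_nbhs_nbhs.
congr Complex; apply: near_eq_derive; apply: filterS nU => y Uy; by rewrite fg.
Qed.

Lemma wirtinger_near f g x k : U x -> (forall y, U y -> f y = g y) ->
  wirtinger k f x = wirtinger k g x.
Proof. by move=> Ux fg; rewrite /wirtinger !(cderive_near _ Ux fg). Qed.

Lemma cderiveD f g x v : U x -> csmooth U f -> csmooth U g ->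
  cderive v (fun y => f y + g y) x = cderive v f x + cderive v g x.
Proof.
move=> Ux [fr fi] [gr gi]; apply/eqP; rewrite eq_complex /=; apply/andP; split; apply/eqP.
- rewrite -(deriveD (smooth_on_derivable Ux fr) (smooth_on_derivable Ux gr)).
  by apply: (congr1 (fun h => 'D_v h x)); apply/funext => y; rewrite fctE raddfD.
- rewrite -(deriveD (smooth_on_derivable Ux fi) (smooth_on_derivable Ux gi)).
  by apply: (congr1 (fun h => 'D_v h x)); apply/funext => y; rewrite fctE raddfD.
Qed.

Lemma cderiveM f g x v : U x -> csmooth U f -> csmooth U g ->
  cderive v (fun y => f y * g y) x = cderive v f x * g x + f x * cderive v g x.
Proof.
move=> Ux [fr fi] [gr gi].
have Dfr : derivable _ x v := smooth_on_derivable Ux fr.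
have Dfi : derivable _ x v := smooth_on_derivable Ux fi.
have Dgr : derivable _ x v := smooth_on_derivable Ux gr.
have Dgi : derivable _ x v := smooth_on_derivable Ux gi.
apply/eqP; rewrite eq_complex; apply/andP; split; apply/eqP.
- transitivity ('D_v ((fun y => complex.Re (f y)) * (fun y => complex.Re (g y))
     - (fun y => complex.Im (f y)) * (fun y => complex.Im (g y))) x).
    apply: (congr1 (fun h => 'D_v h x)); apply/funext => y.
    by rewrite !fctE; case: (f y) (g y) => ? ? [].
  rewrite (deriveB (derivableM Dfr Dgr) (derivableM Dfi Dgi)).
  rewrite (deriveM Dfr Dgr) (deriveM Dfi Dgi) /cderive.
  by case: (f x) (g x) => ? ? [? ?] /=; rewrite /GRing.scale /=; ring.
- transitivity ('D_v ((fun y => complex.Re (f y)) * (fun y => complex.Im (g y))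
     + (fun y => complex.Im (f y)) * (fun y => complex.Re (g y))) x).
    apply: (congr1 (fun h => 'D_v h x)); apply/funext => y.
    by rewrite !fctE; case: (f y) (g y) => ? ? [].
  rewrite (deriveD (derivableM Dfr Dgi) (derivableM Dfi Dgr)).
  rewrite (deriveM Dfr Dgi) (deriveM Dfi Dgr) /cderive.
  by case: (f x) (g x) => ? ? [? ?] /=; rewrite /GRing.scale /=; ring.
Qed.

Lemma cderive_cst (z : C) x v : cderive v (fun _ => z) x = 0.
Proof. by rewrite /cderive !derive_cst. Qed.

Lemma cderiveZ (z : C) f x v : U x -> csmooth U f ->
  cderive v (fun y => z * f y) x = z * cderive v f x.
Proof.
by move=> Ux sf; rewrite cderiveM// ?cderive_cst ?mul0r ?add0r//; exact: csmooth_cst.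
Qed.

Lemma cderiveB f g x v : U x -> csmooth U f -> csmooth U g ->
  cderive v (fun y => f y - g y) x = cderive v f x - cderive v g x.
Proof.
move=> Ux sf sg; rewrite -[RHS]addr0 -(mulN1r (cderive v g x)) addr0.
rewrite -cderiveZ// -cderiveD//; last by apply: csmoothM => //; exact: csmooth_cst.
by apply: cderive_near => // y _; rewrite mulN1r.
Qed.

Lemma cderive_sum n (f : 'I_n -> V -> C) x v : U x -> (forall i, csmooth U (f i)) ->
  cderive v (fun y => \sum_i f i y) x = \sum_i cderive v (f i) x.
Proof.
move=> Ux; elim: n f => [|n IH] f sf.
  by rewrite big_ord0 -[RHS](cderive_cst 0 x v); apply: cderive_near => // y _; rewrite big_ord0.
rewrite big_ord_recl -IH// -cderiveD//; last exact: csmooth_sum.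
by apply: cderive_near => // y _; rewrite big_ord_recl.
Qed.

Lemma wirtingerD f g x k : U x -> csmooth U f -> csmooth U g ->
  wirtinger k (fun y => f y + g y) x = wirtinger k f x + wirtinger k g x.
Proof. by move=> Ux sf sg; rewrite /wirtinger !cderiveD//; ring. Qed.

Lemma wirtingerB f g x k : U x -> csmooth U f -> csmooth U g ->
  wirtinger k (fun y => f y - g y) x = wirtinger k f x - wirtinger k g x.
Proof. by move=> Ux sf sg; rewrite /wirtinger !cderiveB//; ring. Qed.

Lemma wirtingerM f g x k : U x -> csmooth U f -> csmooth U g ->
  wirtinger k (fun y => f y * g y) x = wirtinger k f x * g x + f x * wirtinger k g x.
Proof. by move=> Ux sf sg; rewrite /wirtinger !cderiveM//; ring. Qed.

Lemma wirtingerZ (z : C) f x k : U x -> csmooth U f ->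
  wirtinger k (fun y => z * f y) x = z * wirtinger k f x.
Proof. by move=> Ux sf; rewrite /wirtinger !cderiveZ//; ring. Qed.

Lemma wirtinger_sum n (f : 'I_n -> V -> C) x k : U x -> (forall i, csmooth U (f i)) ->
  wirtinger k (fun y => \sum_i f i y) x = \sum_i wirtinger k (f i) x.
Proof.
move=> Ux sf; rewrite /wirtinger !cderive_sum// !(mulr_sumr, =^~ sumrB).
by [].
Qed.

Lemma cderive_symmetric f x u v : U x -> csmooth U f ->
  cderive u (cderive v f) x = cderive v (cderive u f) x.
Proof.
move=> Ux [fr fi]; rewrite /cderive /=.
by rewrite (derive_symmetric u v oU Ux (fr 3%N)) (derive_symmetric u v oU Ux (fi 3%N)).
Qed.

(** Expanded into real derivatives, exchanging [j] and [k] exchanges the two terms with exactly one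
    [J0]; they carry the same coefficient, as [alg] records. *)
Lemma wirtinger_symmetric f x j k : U x -> csmooth U f ->
  wirtinger j (wirtinger k f) x = wirtinger k (wirtinger j f) x.
Proof.
move=> Ux sf.
have sd w := csmooth_cderive w sf.
have si w : csmooth U (fun y => 'i%C * cderive w f y).
  by apply: csmoothM (sd w); exact: csmooth_cst.
have W w k' : cderive w (wirtinger k' f) x =
    2^-1 * (cderive w (cderive (ex R k') f) x
            - 'i%C * cderive w (cderive (J0 (ex R k')) f) x).
  rewrite (cderiveZ 2^-1 w Ux (csmoothB (sd _) (si _))).
  by rewrite (cderiveB w Ux (sd _) (si _)) (cderiveZ 'i%C w Ux (sd _)).
have E j' k' : wirtinger j' (wirtinger k' f) x =
  2^-1 * (2^-1 * (cderive (ex R j') (cderive (ex R k') f) x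
                  - 'i%C * cderive (ex R j') (cderive (J0 (ex R k')) f) x)
   - 'i%C * (2^-1 * (cderive (J0 (ex R j')) (cderive (ex R k') f) x
                  - 'i%C * cderive (J0 (ex R j')) (cderive (J0 (ex R k')) f) x))).
  exact: (congr2 (fun p q => 2^-1 * (p - 'i%C * q)) (W _ _) (W _ _)).
have alg (z a b c d : C) : 2^-1 * (2^-1 * (a - z * b) - z * (2^-1 * (c - z * d))) =
    2^-1 * (2^-1 * (a - z * c) - z * (2^-1 * (b - z * d))) by ring.
have sym u v := @cderive_symmetric f x u v Ux sf.
apply: (etrans (E j k)); apply: (etrans _ (esym (E k j))); apply: (etrans (alg _ _ _ _ _)).
exact: (f_equal4 (fun a b c d =>
  2^-1 * (2^-1 * (a - 'i%C * b) - 'i%C * (2^-1 * (c - 'i%C * d))))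
  (sym _ _) (sym _ _) (sym _ _) (sym _ _)).
Qed.

End ComplexCalculus.

(** * Kaehler metrics *)

(** Integrability condition of a linear system d_a h_k = A^l_k h_l: both sides are mixed second
    derivatives with the system inserted twice, and the coefficient of [h s] is a curvature
    component. *)
Lemma second_derivative_swap (K : comRingType) (d1 d2 G1 G2 : 'I_2 -> K)
    (A1 A2 : 'I_2 -> 'I_2 -> K) (h : 'I_2 -> K) :
  \sum_l (d1 l * h l + G1 l * \sum_s A2 s l * h s) =
  \sum_l (d2 l * h l + G2 l * \sum_s A1 s l * h s) ->
  \sum_s (d1 s - d2 s - \sum_l (G2 l * A1 s l - G1 l * A2 s l)) * h s = 0.
Proof.
rewrite !big_ord_recl !big_ord0 !addr0 => /eqP; rewrite -subr_eq0 => /eqP e.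
by apply: (etrans _ e); ring.
Qed.

Section KahlerFlatness.
Variables (R : realType) (M : topologicalType) (S : complex_surface R M).
Local Notation V := ('C2 R).
Local Notation C := R[i].
Variables (g : pseudo_kahler_metric S) (nabla : complex_connection S).
Hypothesis LC : levi_civita g nabla.
Variable phi : chart R M.
Hypothesis aphi : atlas S phi.
Local Notation U := (cod phi).
Local Notation Gam i j k := (complex_christoffel nabla phi i j k).

Let oU : open U := @cod_open _ _ phi.

Definition hermitian_form (x u v : V) : C :=
  Complex (metric g phi x u v) (metric g phi x u (J0 v)).

Lemma J0_J0 (v : V) : J0 (J0 v) = - v.
Proof. by rewrite /J0 row_mxKl row_mxKr -opp_row_mx hsubmxK. Qed.

Section AtPoint.
Variable x : V.
Hypothesis Ux : U x.

Lemma metricD u w v : metric g phi x (u + w) v = metric g phi x u v + metric g phi x w v.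
Proof.
have := metric_lin g aphi Ux v 1 u w; rewrite scale1r !(metric_sym g aphi Ux v) => ->.
by rewrite /= /GRing.scale /= mul1r.
Qed.

Lemma metricZ a u v : metric g phi x (a *: u) v = a * metric g phi x u v.
Proof.
have m0 : metric g phi x 0 v = 0.
  by have := metricD 0 0 v; rewrite addr0 => /eqP; rewrite -subr_eq0 opprD addNKr oppr_eq0 => /eqP.
have := metric_lin g aphi Ux v a u 0; rewrite addr0 !(metric_sym g aphi Ux v) => ->.
by rewrite m0 addr0.
Qed.

Lemma metricNr u v : metric g phi x u (- v) = - metric g phi x u v.
Proof. by rewrite -scaleN1r (metric_sym g aphi Ux) metricZ (metric_sym g aphi Ux) mulN1r. Qed.

Lemma metric_J0l u v : metric g phi x (J0 u) v = - metric g phi x u (J0 v).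
Proof. by rewrite -(metric_hermitian g aphi Ux (J0 u)) J0_J0 -scaleN1r metricZ mulN1r. Qed.

Lemma hermitianD u w v :
  hermitian_form x (u + w) v = hermitian_form x u v + hermitian_form x w v.
Proof. by rewrite /hermitian_form !metricD; apply/eqP; rewrite eq_complex /= !eqxx. Qed.

Lemma hermitianZ (a : R) u v :
  hermitian_form x (a *: u) v = a%:C%C * hermitian_form x u v.
Proof.
rewrite /hermitian_form !metricZ; apply/eqP.
by rewrite eq_complex /= !(mul0r, subr0, addr0) !eqxx.
Qed.

Lemma hermitian_J0l u v : hermitian_form x (J0 u) v = 'i%C * hermitian_form x u v.
Proof.
rewrite /hermitian_form !metric_J0l J0_J0 metricNr opprK; apply/eqP.
by rewrite eq_complex /= !(mul0r, mul1r, sub0r, add0r) !eqxx.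
Qed.

Lemma hermitian_J0r u v : hermitian_form x u (J0 v) = - 'i%C * hermitian_form x u v.
Proof.
rewrite /hermitian_form J0_J0 metricNr; apply/eqP.
by rewrite eq_complex /= !(oppr0, mul0r, mulN1r, opprK, sub0r, add0r) !eqxx.
Qed.

Lemma vector_dz_decomposition (w : V) : w = \sum_l
  (complex.Re (dz l w) *: ex R l + complex.Im (dz l w) *: J0 (ex R l)).
Proof.
rewrite {1}(_ : w = row_mx (lsubmx w) (rsubmx w)); last by rewrite hsubmxK.
rewrite /dz /=.
under eq_bigr => l _.
  rewrite /J0 /ex row_mxKl row_mxKr oppr0 !scale_row_mx add_row_mx !scaler0 addr0 add0r.
  over.
rewrite [LHS](_ : _ = row_mx (\sum_l lsubmx w 0 l *: delta_mx 0 l)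
  (\sum_l rsubmx w 0 l *: delta_mx 0 l)); last by rewrite -!row_sum_delta.
by rewrite !big_ord_recl !big_ord0 !addr0 add_row_mx.
Qed.

Lemma hermitian_dz_decomposition w v :
  hermitian_form x w v = \sum_l dz l w * hermitian_form x (ex R l) v.
Proof.
rewrite {1}(vector_dz_decomposition w) !big_ord_recl !big_ord0 !addr0.
rewrite !hermitianD !hermitianZ !hermitian_J0l !mulrA.
by congr (_ + _); rewrite -mulrDl; congr (_ * _);
  apply/eqP; rewrite eq_complex /= !(mul0r, mulr0, mulr1, subr0, addr0, add0r) !eqxx.
Qed.

(** The sum is [hermitian_form x w v] for the vector [w] with complex coordinates [F], and its real
    part is the metric. *)
Lemma hermitian_nondegenerate (F : 'I_2 -> C) :
  (forall v, \sum_l F l * hermitian_form x (ex R l) v = 0) -> forall l, F l = 0.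
Proof.
move=> F0 l.
pose w : V := row_mx (\row_l complex.Re (F l)) (\row_l complex.Im (F l)).
have dzw k : dz k w = F k by rewrite /dz row_mxKl row_mxKr !mxE; case: (F k).
suff w0 : w = 0 by rewrite -dzw w0 /dz !mxE.
apply: (metric_nondegenerate (p := g) aphi Ux) => v.
have := F0 v; under eq_bigr do rewrite -dzw.
by rewrite -hermitian_dz_decomposition => /(congr1 (@complex.Re R)).
Qed.

End AtPoint.

Lemma hermitian_smooth k v : csmooth U (fun x => hermitian_form x (ex R k) v).
Proof. by split=> n; exact: metric_smooth. Qed.

Lemma complex_christoffel_smooth i j k : csmooth U (Gam i j k).
Proof.
apply: (@csmooth_eq _ _ oU (fun x => dz i (christoffel nabla phi x (ex R j) (ex R k)))).
  by move=> x Ux; rewrite complex_christoffelE.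
have sG n := christoffel_smooth nabla aphi (ex R j) (ex R k) n.
split=> n; have [/(_ (sG n)) H _] := times_differentiable_mxP n
    (fun x => christoffel nabla phi x (ex R j) (ex R k)) oU.
  by apply: times_differentiable_eq (H 0 (lshift 2 i)) => // x _; rewrite /= mxE.
by apply: times_differentiable_eq (H 0 (rshift 2 i)) => // x _; rewrite /= mxE.
Qed.

Lemma cderive_hermitian x u k v : U x ->
  cderive u (fun y => hermitian_form y (ex R k) v) x =
  hermitian_form x (christoffel nabla phi x u (ex R k)) v
  + hermitian_form x (ex R k) (christoffel nabla phi x u v).
Proof.
move=> Ux; have [_ lc] := LC.
rewrite /cderive /hermitian_form /= !(lc _ _ aphi Ux).
rewrite (complex_connection_J_parallel nabla aphi Ux).
by apply/eqP; rewrite eq_complex /= !eqxx.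
Qed.

(** In [ex m - i J0 (ex m)] the terms that are complex-linear in the direction double, while those
    from the conjugate-linear second argument cancel. *)
Lemma wirtinger_hermitian x m k v : U x ->
  wirtinger m (fun y => hermitian_form y (ex R k) v) x =
  \sum_l Gam l m k x * hermitian_form x (ex R l) v.
Proof.
move=> Ux; rewrite /wirtinger !cderive_hermitian// !christoffel_J0l//.
rewrite hermitian_J0l// hermitian_J0r//.
transitivity (hermitian_form x (christoffel nabla phi x (ex R m) (ex R k)) v).
  move: (hermitian_form _ _ _) (hermitian_form _ _ _) => a b.
  have i2 := i_squared R; move: 'i%C i2 => I i2.
  by field: i2.
rewrite hermitian_dz_decomposition//; apply: eq_bigr => l _.
by rewrite complex_christoffelE.
Qed.

Lemma christoffel_flat x n m k s : U x ->
  wirtinger n (Gam s m k) x - wirtinger m (Gam s n k) x =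
  \sum_l (Gam l n k x * Gam s m l x - Gam l m k x * Gam s n l x).
Proof.
move=> Ux.
pose F s := wirtinger n (Gam s m k) x - wirtinger m (Gam s n k) x -
  \sum_l (Gam l n k x * Gam s m l x - Gam l m k x * Gam s n l x).
suff : F s = 0 by move/eqP; rewrite subr_eq0 => /eqP.
apply: (hermitian_nondegenerate Ux) => v {s}.
have sh l := hermitian_smooth l v.
have sG := complex_christoffel_smooth.
have D2 a b : wirtinger a (wirtinger b (fun y => hermitian_form y (ex R k) v)) x =
   \sum_l (wirtinger a (Gam l b k) x * hermitian_form x (ex R l) v +
      Gam l b k x * \sum_s Gam s a l x * hermitian_form x (ex R s) v).
  rewrite (wirtinger_near oU _ Ux (fun y Uy => wirtinger_hermitian b k v Uy)).
  rewrite (wirtinger_sum oU _ Ux (fun l => csmoothM oU (sG l b k) (sh l))).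
  apply: eq_bigr => l _; rewrite (wirtingerM _ Ux (sG l b k) (sh l)).
  by rewrite wirtinger_hermitian.
have e := etrans (esym (D2 n m)) (etrans (wirtinger_symmetric oU n m Ux (sh k)) (D2 m n)).
exact: (@second_derivative_swap _ (fun s => wirtinger n (Gam s m k) x)
  (fun s => wirtinger m (Gam s n k) x) (fun l => Gam l m k x) (fun l => Gam l n k x)
  (fun s l => Gam s m l x) (fun s l => Gam s n l x)
  (fun s => hermitian_form x (ex R s) v) e).
Qed.

End KahlerFlatness.

(** * The Liouville curvature *)

(* dG n i j k stands for d_n G^i_jk. *)
Section LiouvilleAlgebra.
Variables (K : numFieldType) (G : 'I_2 -> 'I_2 -> 'I_2 -> K).
Variables (dG : 'I_2 -> 'I_2 -> 'I_2 -> 'I_2 -> K).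
Hypothesis G_sym : forall i j k, G i j k = G i k j.
Hypothesis dG_sym : forall n i j k, dG n i j k = dG n i k j.
Hypothesis G_flat : forall s k,
  dG 0 s 1 k - dG 1 s 0 k = \sum_l (G l 0 k * G s 1 l - G l 1 k * G s 0 l).

Let p j := 3^-1 * \sum_l G l l j.
Let dp n j := 3^-1 * \sum_l dG n l l j.
Let P i j k := G i j k - ((i == k)%:R * p j + (i == j)%:R * p k).
Let dP n i j k := dG n i j k - ((i == k)%:R * dp n j + (i == j)%:R * dp n k).
Let Q i j := \sum_k p k * G k i j - p i * p j - dp i j.

(** Trace of [G_flat] over [s = k]: the quadratic terms form the trace of a commutator, which is
    zero. *)
Lemma flat_dp_sym : dp 0 1 = dp 1 0.
Proof.
rewrite /dp !sum_ord2.
have := G_flat 0 0; have := G_flat 1 1; rewrite !sum_ord2.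
rewrite !(G_sym _ 1 0) !(dG_sym _ _ 1 0) => e1 e0.
have e := congr2 (fun a b => 3^-1 * (a + b)) e0 e1.
apply/eqP; rewrite -subr_eq0; apply/eqP.
by apply: (etrans _ (etrans (etrans e _) (mulr0 3^-1))); [ring|congr (_ * _); ring].
Qed.

(** Flatness contracted over the upper index and a derivative index turns the divergence d_k G^k_ij
    into 3 d_i p_j + G^l_kj G^k_il - 3 p_l G^l_ij; the products of two [G] then cancel. *)
Lemma flat_schouten i j :
  \sum_k \sum_l P k i l * P l j k - \sum_k dP k k i j = Q i j.
Proof.
(* Flatness serves as a rewrite rule that eliminates [dG 0 s 1 k], also in the form [dG 0 s 0 1]
   obtained from symmetry. *)
have f s k : dG 0 s 1 k = dG 1 s 0 k + \sum_l (G l 0 k * G s 1 l - G l 1 k * G s 0 l).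
  by rewrite -G_flat subrKC.
have f01 s : dG 0 s 0 1 = dG 1 s 0 0 + \sum_l (G l 0 0 * G s 1 l - G l 0 1 * G s 0 l).
  by rewrite dG_sym f; under [in RHS]eq_bigr do rewrite (G_sym _ 0 1).
have f11 s := f s 1.
rewrite /Q /P /dP /dp /p.
case: (ord2P i) => ->; case: (ord2P j) => ->; rewrite !sum_ord2 /=;
 rewrite ?(dG_sym _ _ 1 0) ?f11 ?f01 !sum_ord2 ?(G_sym _ 1 0); by field.
Qed.

(** The first two brackets are d_1 Q_i2 and d_2 Q_i1 expanded by the Leibniz rule; [t] is the common
    value of d_1 d_i p_2 and d_2 d_i p_1. *)
Lemma flat_liouville (t : K) i :
  (\sum_k (dp 0 k * G k i 1 + p k * dG 0 k i 1) - (dp 0 i * p 1 + p i * dp 0 1) - t)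
  - (\sum_k (dp 1 k * G k i 0 + p k * dG 1 k i 0) - (dp 1 i * p 0 + p i * dp 1 0) - t)
  + \sum_j (Q j 0 * P j i 1 - Q j 1 * P j i 0) = 0.
Proof.
have ds := flat_dp_sym.
have f k : dG 0 k i 1 = dG 1 k i 0 + \sum_l (G l 0 i * G k 1 l - G l 1 i * G k 0 l).
  by rewrite (dG_sym 0) (dG_sym 1) -G_flat subrKC.
rewrite /Q /P !sum_ord2 !f !sum_ord2 ds.
case: (ord2P i) => ->; rewrite ?ds /= ?(G_sym _ 1 0); ring.
Qed.

End LiouvilleAlgebra.

(** [D u k] stands for the derivative along [u] of the k-th coefficient of a form; it is not assumed
    linear in [u], since only its values at [ex] and [J0 ex] occur. *)
Lemma eval_dzdz_curvature (R : realType) (D : 'C2 R -> 'I_2 -> R[i])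
    (P Q : 'I_2 -> 'I_2 -> R[i]) :
  eval_dzdz (fun u v =>
    \sum_k (D u k * dz k v - D v k * dz k u)
    + \sum_j ((\sum_k P j k * dz k u) * (\sum_l Q j l * dz l v)
              - (\sum_k P j k * dz k v) * (\sum_l Q j l * dz l u))) 0 1
  = 2^-1 * (D (ex R 0) 1 - 'i%C * D (J0 (ex R 0)) 1)
    - 2^-1 * (D (ex R 1) 0 - 'i%C * D (J0 (ex R 1)) 0)
    + \sum_j (P j 0 * Q j 1 - P j 1 * Q j 0).
Proof.
rewrite /eval_dzdz !sum_ord2 !dz_J0 !dz_ex /=.
have i2 := i_squared R; move: 'i%C i2 => I i2.
move: (D (ex R 0)) (D (J0 (ex R 0))) (D (ex R 1)) (D (J0 (ex R 1))) => a b c d.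
by field: i2.
Qed.

(** * The coefficients L_i in terms of [Pi2] and [Pi3] *)

Section CartanCurvature.
Variables (R : realType) (M : topologicalType) (S : complex_surface R M).
Local Notation V := ('C2 R).
Local Notation C := R[i].
Variables (nabla : complex_connection S) (phi : chart R M).
Hypothesis aphi : atlas S phi.
Local Notation U := (cod phi).
Local Notation Gam i j k := (complex_christoffel nabla phi i j k).
Local Notation Pi3 := (Pi3 nabla phi).
Local Notation Pi2 := (Pi2 nabla phi).

Let oU : open U := @cod_open _ _ phi.

Definition trace_form (j : 'I_2) (x : V) : C := 3^-1 * \sum_l Gam l l j x.

Lemma trace_form_smooth j : csmooth U (trace_form j).
Proof.
apply: csmoothM => //; first exact: csmooth_cst.
by apply: csmooth_sum => // l; exact: complex_christoffel_smooth.
Qed.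

Lemma Pi3E i j k x :
  Pi3 i j k x = Gam i j k x - ((i == k)%:R * trace_form j x + (i == j)%:R * trace_form k x).
Proof. by rewrite /Defs.Pi3 /trace_form !sum_ord2; ring. Qed.

Let delta_smooth (b : bool) j : csmooth U (fun x => b%:R * trace_form j x).
Proof.
by apply: csmoothM => //; [exact: csmooth_cst|exact: trace_form_smooth].
Qed.

Lemma Pi3_smooth i j k : csmooth U (Pi3 i j k).
Proof.
apply: (csmooth_eq oU (fun x _ => esym (Pi3E i j k x))).
apply: csmoothB => //; first exact: complex_christoffel_smooth.
exact: csmoothD.
Qed.

Lemma Pi2_smooth i j : csmooth U (Pi2 i j).
Proof.
apply: csmoothB => //.
  apply: csmooth_sum => // k; apply: csmooth_sum => // l.
  by apply: csmoothM => //; exact: Pi3_smooth.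
by apply: csmooth_sum => // k; apply: csmooth_wirtinger => //; exact: Pi3_smooth.
Qed.

Lemma wirtinger_trace_form n j x : U x ->
  wirtinger n (trace_form j) x = 3^-1 * \sum_l wirtinger n (Gam l l j) x.
Proof.
move=> Ux; have sG l := complex_christoffel_smooth nabla aphi l l j.
rewrite (wirtingerZ 3^-1 n Ux (csmooth_sum oU sG)).
by rewrite (wirtinger_sum oU n Ux sG).
Qed.

Lemma wirtinger_Pi3 n i j k x : U x ->
  wirtinger n (Pi3 i j k) x = wirtinger n (Gam i j k) x
  - ((i == k)%:R * wirtinger n (trace_form j) x
     + (i == j)%:R * wirtinger n (trace_form k) x).
Proof.
move=> Ux; have sG := complex_christoffel_smooth nabla aphi i j k.
rewrite (wirtinger_near oU n Ux (fun y _ => Pi3E i j k y)).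
rewrite (wirtingerB oU n Ux sG (csmoothD oU (delta_smooth _ _) (delta_smooth _ _))).
rewrite (wirtingerD n Ux (delta_smooth _ _) (delta_smooth _ _)).
by rewrite !(wirtingerZ _ n Ux (trace_form_smooth _)).
Qed.

Lemma curvature_0iE i x u v : U x ->
  curvature_0i nabla phi i x u v =
    \sum_k (cderive u (Pi2 i k) x * dz k v - cderive v (Pi2 i k) x * dz k u)
    + \sum_j ((\sum_k Pi2 j k x * dz k u) * (\sum_l Pi3 j i l x * dz l v)
              - (\sum_k Pi2 j k x * dz k v) * (\sum_l Pi3 j i l x * dz l u)).
Proof.
move=> Ux.
have formE w : (fun y => cartan_form nabla phi y w (lshift 2 0) (rshift 1 i)) =
    (fun y => \sum_k Pi2 i k y * dz k w).
  by apply/funext => y; rewrite /cartan_form block_mxEur mxE.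
have dform w w' : cderive w (fun y => cartan_form nabla phi y w' (lshift 2 0) (rshift 1 i)) x =
    \sum_k cderive w (Pi2 i k) x * dz k w'.
  have sc k : csmooth U (fun _ : V => dz k w') by exact: csmooth_cst.
  rewrite formE (cderive_sum oU w Ux (fun k => csmoothM oU (Pi2_smooth i k) (sc k))).
  apply: eq_bigr => k _; rewrite (cderiveM w Ux (Pi2_smooth i k) (sc k)).
  by rewrite cderive_cst mulr0 addr0.
have mulE w w' :
    (cartan_form nabla phi x w *m cartan_form nabla phi x w') (lshift 2 0) (rshift 1 i) =
    \sum_j (\sum_k Pi2 j k x * dz k w) * (\sum_l Pi3 j i l x * dz l w').
  (* The upper left block of the form is 0, so only the product of the [Pi2] row with the [Pi3]
     block contributes. *)
  rewrite /cartan_form mulmx_block block_mxEur mul0mx add0r mxE.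
  by apply: eq_bigr => j _; rewrite !mxE.
transitivity (cartan_curvature nabla phi x u v (lshift 2 0) (rshift 1 i)).
  by rewrite /curvature_0i mxE mxE.
rewrite /cartan_curvature [LHS]mxE; congr (_ + _).
  by rewrite mxE !dform -sumrB.
have subE (A B : 'M[C]_(1 + 2)) a b : (A - B) a b = A a b - B a b by rewrite !mxE.
by rewrite subE !mulE -sumrB.
Qed.

(** Serves twice: for the vanishing of L_i on the Levi-Civita connection, and for its dependence on
    [nabla] through [Pi3] alone. *)
Lemma liouville_coef_Pi i x : U x -> liouville_coef nabla phi i x =
  wirtinger 0 (Pi2 i 1) x - wirtinger 1 (Pi2 i 0) x
  + \sum_j (Pi2 j 0 x * Pi3 j i 1 x - Pi2 j 1 x * Pi3 j i 0 x).
Proof.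
move=> Ux; apply: (etrans _ (eval_dzdz_curvature (fun u k => cderive u (Pi2 i k) x)
  (fun j k => Pi2 j k x) (fun j l => Pi3 j i l x))).
by congr eval_dzdz; apply/funext => u; apply/funext => v; exact: curvature_0iE.
Qed.

End CartanCurvature.

Section KahlerLiouville.
Variables (R : realType) (M : topologicalType) (S : complex_surface R M).
Local Notation V := ('C2 R).
Local Notation C := R[i].
Variables (g : pseudo_kahler_metric S) (nabla : complex_connection S).
Hypothesis LC : levi_civita g nabla.
Variable phi : chart R M.
Hypothesis aphi : atlas S phi.
Local Notation U := (cod phi).
Local Notation Gam i j k := (complex_christoffel nabla phi i j k).
Local Notation p := (trace_form nabla phi).

Let oU : open U := @cod_open _ _ phi.
Let sG i j k : csmooth U (Gam i j k) := complex_christoffel_smooth nabla aphi i j k.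
Let sp j : csmooth U (p j) := trace_form_smooth nabla aphi j.
Let swp n j : csmooth U (wirtinger n (p j)) := csmooth_wirtinger oU n (sp j).

Let Gam_sym x i j k : U x -> Gam i j k x = Gam i k j x.
Proof. exact: complex_christoffel_sym. Qed.

Let dGam_sym x n i j k : U x -> wirtinger n (Gam i j k) x = wirtinger n (Gam i k j) x.
Proof. by move=> Ux; apply: (wirtinger_near oU n Ux) => y Uy; exact: Gam_sym. Qed.

Let Gam_flat x s k (Ux : U x) := christoffel_flat LC aphi 0 1 k s Ux.

Let wp n j x (Ux : U x) := wirtinger_trace_form nabla aphi n j Ux.

(** The derivative of p is kept as a trace of derivatives of the symbols, to match the formal [Q] of
    the algebraic identities; [kahler_Pi2] is the form that can be differentiated again. *)
Let kahler_Pi2_flat i j x : U x -> Pi2 nabla phi i j x =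
  \sum_k p k x * Gam k i j x - p i x * p j x
  - 3^-1 * \sum_l wirtinger i (Gam l l j) x.
Proof.
move=> Ux; apply: (etrans _ (@flat_schouten C (fun i j k => Gam i j k x)
  (fun n i j k => wirtinger n (Gam i j k) x)
  (fun i j k => Gam_sym i j k Ux) (fun n i j k => dGam_sym n i j k Ux)
  (fun s k => Gam_flat s k Ux) i j)).
rewrite /Pi2; congr (_ - _).
  apply: eq_bigr => k _; apply: eq_bigr => l _.
  exact: congr2 (Pi3E _ _ _ _ _ _) (Pi3E _ _ _ _ _ _).
apply: eq_bigr => k _; apply: (etrans (wirtinger_Pi3 nabla aphi _ _ _ _ Ux)).
exact: (congr2 (fun a b => wirtinger k (Gam k i j) x - ((k == j)%:R * a + (k == i)%:R * b))
  (wp _ _ Ux) (wp _ _ Ux)).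
Qed.

Lemma kahler_Pi2 i j x : U x -> Pi2 nabla phi i j x =
  \sum_k p k x * Gam k i j x - p i x * p j x - wirtinger i (p j) x.
Proof.
move=> Ux; apply: (etrans (kahler_Pi2_flat i j Ux)).
by congr (_ - _); apply: esym; exact: wp.
Qed.

Lemma wirtinger_kahler_Pi2 n i j x : U x -> wirtinger n (Pi2 nabla phi i j) x =
  \sum_k (wirtinger n (p k) x * Gam k i j x + p k x * wirtinger n (Gam k i j) x)
  - (wirtinger n (p i) x * p j x + p i x * wirtinger n (p j) x)
  - wirtinger n (wirtinger i (p j)) x.
Proof.
move=> Ux; rewrite (wirtinger_near oU n Ux (fun y Uy => kahler_Pi2 i j Uy)).
have s1 k : csmooth U (fun y => p k y * Gam k i j y) := csmoothM oU (sp k) (sG k i j).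
have s2 : csmooth U (fun y => p i y * p j y) := csmoothM oU (sp i) (sp j).
rewrite (wirtingerB oU n Ux (csmoothB oU (csmooth_sum oU s1) s2) (swp i j)).
rewrite (wirtingerB oU n Ux (csmooth_sum oU s1) s2) (wirtinger_sum oU n Ux s1).
rewrite (wirtingerM n Ux (sp i) (sp j)); congr (_ - _ - _).
by apply: eq_bigr => k _; rewrite (wirtingerM n Ux (sp k) (sG k i j)).
Qed.

Lemma trace_form_closed x : U x -> wirtinger 0 (p 1) x = wirtinger 1 (p 0) x.
Proof.
move=> Ux; apply: (etrans (wp 0 1 Ux)); apply: (etrans _ (esym (wp 1 0 Ux))).
exact: (@flat_dp_sym C (fun i j k => Gam i j k x) (fun n i j k => wirtinger n (Gam i j k) x)
  (fun i j k => Gam_sym i j k Ux) (fun n i j k => dGam_sym n i j k Ux)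
  (fun s k => Gam_flat s k Ux)).
Qed.

(** Move d_i outside, use that p is closed on the whole chart domain, and move d_i back. This
    provides the common value [t] of [flat_liouville]. *)
Lemma second_wirtinger_trace_form i x : U x ->
  wirtinger 0 (wirtinger i (p 1)) x = wirtinger 1 (wirtinger i (p 0)) x.
Proof.
move=> Ux; apply: (etrans (wirtinger_symmetric oU 0 i Ux (sp 1))).
apply: (etrans _ (esym (wirtinger_symmetric oU 1 i Ux (sp 0)))).
exact: (wirtinger_near oU i Ux (fun y Uy => trace_form_closed Uy)).
Qed.

Lemma kahler_liouville_coef i x : U x -> liouville_coef nabla phi i x = 0.
Proof.
move=> Ux; apply: (etrans (liouville_coef_Pi nabla aphi i Ux)).
apply: (etrans _ (@flat_liouville C (fun i j k => Gam i j k x)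
  (fun n i j k => wirtinger n (Gam i j k) x)
  (fun i j k => Gam_sym i j k Ux) (fun n i j k => dGam_sym n i j k Ux)
  (fun s k => Gam_flat s k Ux) (wirtinger 1 (wirtinger i (p 0)) x) i)).
have dPi2 n j : wirtinger n (Pi2 nabla phi i j) x =
    \sum_k (3^-1 * (\sum_l wirtinger n (Gam l l k) x) * Gam k i j x
            + p k x * wirtinger n (Gam k i j) x)
    - (3^-1 * (\sum_l wirtinger n (Gam l l i) x) * p j x
       + p i x * (3^-1 * \sum_l wirtinger n (Gam l l j) x))
    - wirtinger n (wirtinger i (p j)) x.
  apply: (etrans (wirtinger_kahler_Pi2 n i j Ux)); congr (_ - _ - _).
    apply: eq_bigr => k _.
    exact: (congr1 (fun z => z * Gam k i j x + p k x * wirtinger n (Gam k i j) x) (wp n k Ux)).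
  exact: (congr2 (fun a b => a * p j x + p i x * b) (wp n i Ux) (wp n j Ux)).
congr (_ - _ + _).
- apply: (etrans (dPi2 0 1)).
  exact: (congr2 +%R erefl (congr1 -%R (second_wirtinger_trace_form i Ux))).
- exact: dPi2.
- apply: eq_bigr => j _.
  exact: (f_equal4 (fun a b c d => a * b - c * d)
    (kahler_Pi2_flat j 0 Ux) (Pi3E nabla phi j i 1 x)
    (kahler_Pi2_flat j 1 Ux) (Pi3E nabla phi j i 0 x)).
Qed.

End KahlerLiouville.

(** L_i involves derivatives of [Pi3] up to second order; these agree because [Pi3] agrees on the
    whole open set [cod phi]. *)
Lemma liouville_coef_invariant (R : realType) (M : topologicalType)
    (S : complex_surface R M) (nabla nabla' : complex_connection S) phi i x :
  complex_projectively_equivalent nabla nabla' -> atlas S phi -> cod phi x ->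
  liouville_coef nabla phi i x = liouville_coef nabla' phi i x.
Proof.
move=> eqv aphi Ux; have oU := @cod_open _ _ phi.
have P3 i' j k y (Uy : cod phi y) := Pi3_projective_invariant i' j k eqv aphi Uy.
have P2 i' j y : cod phi y -> Pi2 nabla phi i' j y = Pi2 nabla' phi i' j y.
  move=> Uy; apply: (congr2 (fun a b => a - b)).
    apply: eq_bigr => k _; apply: eq_bigr => l _.
    exact: (congr2 *%R (P3 _ _ _ _ Uy) (P3 _ _ _ _ Uy)).
  by apply: eq_bigr => k _; apply: (wirtinger_near oU k Uy) => z; exact: P3.
apply: (etrans (liouville_coef_Pi nabla aphi i Ux)).
apply: (etrans _ (esym (liouville_coef_Pi nabla' aphi i Ux))).
apply: (f_equal3 (fun a b c => a - b + c)).
- exact: (wirtinger_near oU _ Ux (fun y Uy => P2 i 1 y Uy)).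
- exact: (wirtinger_near oU _ Ux (fun y Uy => P2 i 0 y Uy)).
- apply: eq_bigr => j _.
  exact: (f_equal4 (fun a b c d => a * b - c * d)
    (P2 j 0 x Ux) (P3 j i 1 x Ux) (P2 j 1 x Ux) (P3 j i 0 x Ux)).
Qed.

Theorem theorem3p1 (R : realType) (M : topologicalType)
    (S : complex_surface R M) (P : complex_projective_structure S) :
  kahler_metrisable P -> liouville_flat P.
Proof.
move=> [g [nabla0 [Pnabla0 LC]]] nabla Pnabla phi x aphi Ux u v w.
have [nabla1 classE] := projective_classP P.
rewrite classE /= in Pnabla0; rewrite classE /= in Pnabla.
(* Both connections are equivalent to the representative [nabla1], hence to each other. *)
have eqv : complex_projectively_equivalent nabla nabla0.
  by move=> I gamma; rewrite -(Pnabla I gamma); exact: Pnabla0.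
rewrite /liouville_curvature big1 ?mul0r// => i _.
by rewrite (liouville_coef_invariant i eqv aphi Ux) (kahler_liouville_coef LC aphi i Ux) mul0r.
Qed.
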